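(* Let $T$ be an automorphism of a standard probability Borel space $(X,\mathcal{B},\mu)$, $G$ a second countable locally compact Abelian group, $\varphi:X\to G$ a measurable map, $\mathcal{S}=(S_g)_{g\in G}$ a $G$-action on a standard probability Borel space $(Y,\mathcal{C},\nu)$, and $T_{\varphi,\mathcal{S}}(x,y)=(Tx,S_{\varphi(x)}(y))$ on $(X\times Y,\mathcal{B}\otimes\mathcal{C},\mu\otimes\nu)$. Assume that $T$ is mildly mixing. Then $T_{\varphi,\mathcal{S}}$ is not mildly mixing if and only if there exist a non-trivial factor $\mathcal{A}\subset\mathcal{C}$ of $\mathcal{S}$ and an automorphism $U$ of $(Y/\mathcal{A},\mathcal{A},\nu|_{\mathcal{A}})$ which is not mildly mixing such that $T_{\varphi,\mathcal{S}}|_{\mathcal{B}\otimes\mathcal{A}}$ is isomorphic to the product automorphism $T\times U$.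
   Context: An automorphism is an invertible measure-preserving transformation. A $G$-action is a measurable group homomorphism $g\mapsto S_g\in\mathrm{Aut}(Y,\mathcal{C},\nu)$. A factor of $\mathcal{S}$ (resp. of an automorphism) is an invariant sub-$\sigma$-algebra (mod null sets); it is non-trivial if it contains a set of measure strictly between $0$ and $1$. Restriction to an invariant sub-$\sigma$-algebra denotes the induced automorphism on the quotient space; $Y/\mathcal{A}$ is the quotient of $Y$ by $\mathcal{A}$. An automorphism $R$ is rigid if there is a sequence $q_n\to\infty$ with $R^{q_n}\to\mathrm{Id}$ strongly as (Koopman) operators on $L^2$. An automorphism is mildly mixing if it has no non-trivial rigid factor (i.e. no non-trivial factor on which the induced automorphism is rigid). *)

(* Defs.v *)
From HB Require Import structures.
From mathcomp Require Export all_boot all_order all_algebra.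
From mathcomp Require Export all_classical all_reals all_analysis measurable_realfun.

Set Implicit Arguments.
Unset Strict Implicit.
Unset Printing Implicit Defensive.

Import Order.TTheory GRing.Theory Num.Theory.
Import numFieldNormedType.Exports.

Local Open Scope classical_set_scope.
Local Open Scope ring_scope.

(* Maps are concrete functions; every identity between maps, and every        *)
(* inclusion between sub-sigma-algebras, is meant modulo null sets.           *)

(* [T] is Borel isomorphic to a Polish space: a separable (equivalently,      *)
(* second countable) complete metric space.  Hausdorffness turns the          *)
(* pseudometric into a metric.                                                *)
Definition standard_borel (R : realType) d (T : measurableType d) : Prop :=
  exists (M : completePseudoMetricType R) (f : T -> M),
    [/\ hausdorff_space M, @second_countable M, bijective f &
        (measurable : set (set T)) =
        preimage_set_system [set: T] f <<s @open M >>].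

Definition measure_preserving (R : realType) d1 d2
    (W1 : measurableType d1) (W2 : measurableType d2)
    (P1 : probability W1 R) (P2 : probability W2 R) (f : W1 -> W2) : Prop :=
  measurable_fun [set: W1] f /\
  forall E, measurable E -> P1 (f @^-1` E) = P2 E.

Definition automorphism (R : realType) d (W : measurableType d)
    (P : probability W R) (V : W -> W) : Prop :=
  measure_preserving P P V /\
  exists V' : W -> W, [/\ measure_preserving P P V',
    \forall w \ae P, V' (V w) = w & \forall w \ae P, V (V' w) = w].

Definition isomorphic (R : realType) d1 d2
    (W1 : measurableType d1) (P1 : probability W1 R) (V1 : W1 -> W1)
    (W2 : measurableType d2) (P2 : probability W2 R) (V2 : W2 -> W2) : Prop :=
  exists (f : W1 -> W2) (g : W2 -> W1),
    measure_preserving P1 P2 f /\ measure_preserving P2 P1 g /\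
    (\forall w \ae P1, g (f w) = w) /\ (\forall w \ae P2, f (g w) = w) /\
    (\forall w \ae P1, f (V1 w) = V2 (f w)).

Section factors.
Context (R : realType) d (W : measurableType d) (P : probability W R).
Implicit Types A B : set (set W).

Definition ae_subset A B : Prop :=
  forall E, A E -> exists2 F, B F & P (E `+` F) = 0%E.

Definition ae_equal A B : Prop := ae_subset A B /\ ae_subset B A.

Definition factor (V : W -> W) A : Prop :=
  [/\ sigma_algebra [set: W] A, A `<=` measurable &
      ae_equal (preimage_set_system [set: W] V A) A].

Definition nontrivial A : Prop := exists2 E, A E & (0 < P E < 1)%E.

(* The quotient W/A is a standard Borel probability space with a              *)
(* measure-preserving map from W whose pulled back sigma-algebra is A; this   *)
(* determines it up to isomorphism.                                           *)
Record quotient_space A := QuotientSpace {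
  quo_display : measure_display ;
  quo_type :> measurableType quo_display ;
  quo_prob : probability quo_type R ;
  quo_map : W -> quo_type ;
  quo_standard : standard_borel R quo_type ;
  quo_map_preserving : measure_preserving P quo_prob quo_map ;
  quo_mapE : ae_equal (preimage_set_system [set: W] quo_map measurable) A
}.

(* [VA] is the automorphism induced by [V] on W/A, written V|_A. *)
Definition restriction (V : W -> W) A (Q : quotient_space A) (VA : Q -> Q) :
    Prop :=
  automorphism (quo_prob Q) VA /\
  \forall w \ae P, quo_map Q (V w) = VA (quo_map Q w).

End factors.

(* Real-valued L^2; strong convergence of the Koopman operators on complex    *)
(* L^2 is equivalent, by splitting into real and imaginary parts.             *)
Definition rigid (R : realType) d (W : measurableType d)
    (P : probability W R) (V : W -> W) : Prop :=
  exists q : nat -> nat, q n @[n --> \oo] --> \oo /\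
    forall f : W -> R, f \in Lfun P 2%:E ->
      ('N[P]_2%:E[EFin \o (fun w => f (iter (q n) V w) - f w)%R])%E @[n --> \oo]
        --> 0%E.

Definition mildly_mixing (R : realType) d (W : measurableType d)
    (P : probability W R) (V : W -> W) : Prop :=
  ~ exists A : set (set W), [/\ factor P V A, nontrivial P A &
      exists (Q : quotient_space P A) (VA : Q -> Q),
        restriction V VA /\ rigid (quo_prob Q) VA].

(* [G] equipped with its Borel sigma-algebra; [g_sigma_algebraType] is not    *)
(* usable directly because [topologicalZmodType] is not a pointed type.       *)
Definition borelType (G : topologicalZmodType) : Type := G.

Section borelType.
Variable G : topologicalZmodType.

HB.instance Definition _ := Choice.copy (borelType G) G.
HB.instance Definition _ := isPointed.Build (borelType G) (0 : G).

Let borel : set (set (borelType G)) := <<s @open G >>.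

HB.instance Definition _ := @isMeasurable.Build default_measure_display
  (borelType G) borel (@sigma_algebra0 _ setT _)
  (@sigma_algebraC (borelType G) _) (@sigma_algebra_bigcup _ setT _).

End borelType.

(* A homomorphism into the group Aut(Y, nu) of automorphisms modulo null      *)
(* sets, measurable for the Borel sigma-algebra of its weak topology, which   *)
(* is generated by the functions V |-> nu (V^-1 A `&` B).                     *)
Definition group_action (R : realType) d (Y : measurableType d)
    (nu : probability Y R) (G : topologicalZmodType) (S : G -> Y -> Y) : Prop :=
  [/\ forall g, automorphism nu (S g),
      (forall g h, \forall y \ae nu, S (g + h) y = S g (S h y)) &
      forall A B : set Y, measurable A -> measurable B ->
        measurable_fun [set: borelType G]
          ((fun g => nu (S g @^-1` A `&` B)) : borelType G -> \bar R)].

(* Measurable in (x, y) as soon as (g, y) |-> S g y is; every measurable       *)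
(* homomorphism into Aut(Y, nu) has such a representative, and two of them    *)
(* give almost everywhere equal skew products.                                *)
Definition skew_product (X Y G : Type) (T : X -> X) (phi : X -> G)
    (S : G -> Y -> Y) (p : X * Y) : X * Y := (T p.1, S (phi p.1) p.2).

Definition product_map (X Y : Type) (T : X -> X) (U : Y -> Y) (p : X * Y) :
  X * Y := (T p.1, U p.2).

Definition tensor_left dX (X : measurableType dX) (Y : Type)
    (A : set (set Y)) : set (set (X * Y)) :=
  <<s [set D | exists E F, [/\ measurable E, A F & D = E `*` F]] >>.
Arguments tensor_left {dX} X {Y} A.

(* Main.v *)
(* Let W be the skew product and suppose that some non-trivial set is rigid for W
   along q. The sets rigid along q form a sigma-algebra, generated modulo null
   sets by a single function h : X * Y -> [0, 1], and h W = U h for a rigid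
   automorphism U of the law of h. Iterates of W act on fibres through elements
   of G, so the L^1-distance from h(x, .) to the G-orbit of a fixed v is a
   function of x that is rigid for T along q, hence constant since T is mildly
   mixing. As L^1(Y) is separable, almost all fibres h(x, .) lie in the closure of
   one G-orbit. Fix such an x0 and let A be generated by h(x0, .). Because
   id x S_g commutes with W, A is G-invariant; approximating h(x, .) by translates
   of h(x0, .) and conversely, (x, y) |-> (x, h(x, y)) generates the product of the
   sigma-algebras of X and A. This map carries W to T x U, and h(x0, .) identifies
   Y/A with the space on which U acts.
   Conversely, a rigid factor of U is a rigid factor of W. *)

Require Import Defs.
From HB Require Import structures.
From mathcomp Require Import ring lra.
Set Implicit Arguments.
Unset Strict Implicit.
Unset Printing Implicit Defensive.
Import Order.TTheory GRing.Theory Num.Theory.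
Import numFieldNormedType.Exports.
Local Open Scope classical_set_scope.
Local Open Scope ring_scope.

(** The identity [S (g + h) = S g \o S h] holds off a null set depending on [g] and [h], so the
    argument works fibre by fibre, with one group element at a time, and never selects [g]
    measurably in [x]. Separability replaces selection: infima over [G] become infima over a
    sequence, and approximations by translates are glued over countably many measurable pieces of
    [X]. Convergence of functions in L1 and convergence of their level sets are used in turn.
    Passing from functions to level sets fails in general at atoms of the law; it is available here
    because the functions compared always have the same law, by preservation of measure for [h]
    along [W] and by the one-orbit property for the fibres. The two product sigma-algebras agree
    because of a uniformity over the fibres: [id x S_g] carries rigid sets to rigid sets and [h]
    generates all of them, so translating [{h in E}] by [g] gives [{h in F}] with a single [F] for
    almost all fibres. This is why [h] must generate the full rigid sigma-algebra, and not merely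
    contain one non-trivial rigid set. *)

Lemma ge0_small_eq0 (R : realType) (x : \bar R) : (0 <= x)%E ->
  (forall e : R, 0 < e -> (x <= e%:E)%E) -> x = 0%E.
Proof.
move=> x0 xe; apply/eqP; rewrite eq_le x0 andbT.
by apply/lee_addgt0Pr => e e0; rewrite add0e; exact: xe.
Qed.

Lemma preimage_setY (aT rT : Type) (f : aT -> rT) (A B : set rT) :
  f @^-1` (A `+` B) = f @^-1` A `+` f @^-1` B.
Proof. by []. Qed.

Lemma sigma_algebra_preim (S T : Type) (K : set (set S)) (f : S -> T) :
  sigma_algebra [set: S] K -> sigma_algebra [set: T] [set A | K (f @^-1` A)].
Proof.
move=> [K0 KC KU]; split => /=.
- by rewrite preimage_set0.
- move=> A KA; rewrite [X in K X](_ : _ = setT `\` f @^-1` A)//; exact: KC.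
- by move=> F KF; rewrite preimage_bigcup; exact: KU.
Qed.

Lemma sigma_generated_ind (T : Type) (G K : set (set T)) :
  sigma_algebra [set: T] K -> G `<=` K -> <<s G >> `<=` K.
Proof. by move=> sK GK; exact: smallest_sub. Qed.

Lemma sigma_algebra_setI (T : Type) (K : set (set T)) A B :
  sigma_algebra [set: T] K -> K A -> K B -> K (A `&` B).
Proof.
move=> [K0 KC KU] KA KB; rewrite -[X in K X]setCK setCI -setTD; apply: (KC).
by rewrite -bigcup2E; apply: (KU) => -[|[|n]] //=; rewrite -setTD; exact: KC.
Qed.

Lemma sigma_algebra_setT (T : Type) (K : set (set T)) :
  sigma_algebra [set: T] K -> K setT.
Proof. by move=> [K0 KC _]; rewrite -[setT]setD0; exact: KC. Qed.

(** * Measure algebras *)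

Section measure_algebra.
Context (R : realType) d (W : measurableType d) (P : probability W R).
Implicit Types A B C E F : set W.

Lemma measurable_setY A B : measurable A -> measurable B -> measurable (A `+` B).
Proof. by move=> mA mB; apply: measurableU; exact: measurableD. Qed.

Lemma setY_triangle A B C : measurable A -> measurable B -> measurable C ->
  (P (A `+` C) <= P (A `+` B) + P (B `+` C))%E.
Proof.
move=> mA mB mC; apply: le_trans (measureU2 _ _ _); last 2 first.
  exact: measurable_setY.
  exact: measurable_setY.
apply: le_measure; rewrite ?inE; try exact: measurable_setY.
  by apply: measurableU; exact: measurable_setY.
move=> w; rewrite /setY /=.
by case: (pselect (A w)); case: (pselect (B w)); case: (pselect (C w)); tauto.
Qed.

Lemma setY_triangle_le A B C (a b c : R) : measurable A -> measurable B ->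
  measurable C -> a + b <= c -> (P (A `+` B) <= a%:E)%E ->
  (P (B `+` C) <= b%:E)%E -> (P (A `+` C) <= c%:E)%E.
Proof.
move=> mA mB mC abc Pa Pb; apply: le_trans (setY_triangle mA mB mC) _.
by apply: le_trans (leeD Pa Pb) _; rewrite -EFinD lee_fin.
Qed.

Lemma setY0_trans A B C : measurable A -> measurable B -> measurable C ->
  P (A `+` B) = 0%E -> P (B `+` C) = 0%E -> P (A `+` C) = 0%E.
Proof.
move=> mA mB mC a b; apply/eqP; rewrite eq_le measure_ge0 andbT.
by rewrite (le_trans (setY_triangle mA mB mC))// a b adde0.
Qed.

Lemma measure_le_setY A B : measurable A -> measurable B ->
  (P A <= P B + P (A `+` B))%E.
Proof.
move=> mA mB; have mY := measurable_setY mA mB.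
apply: le_trans (measureU2 _ _ _) => //.
apply: le_measure; rewrite ?inE//; first exact: measurableU.
by move=> w Aw; rewrite /setY /=; case: (pselect (B w)); tauto.
Qed.

Lemma setY0_measure A B : measurable A -> measurable B ->
  P (A `+` B) = 0%E -> P A = P B.
Proof.
move=> mA mB AB; apply/eqP; rewrite eq_le.
have := measure_le_setY mA mB; rewrite AB adde0 => ->/=.
by have := measure_le_setY mB mA; rewrite setYC AB adde0.
Qed.

Lemma setY_complement A B : ~` A `+` ~` B = A `+` B.
Proof. by rewrite /setY !setDE !setCK setUC setIC (setIC (~` A)). Qed.

Lemma setYU A1 A2 B1 B2 : measurable A1 -> measurable A2 -> measurable B1 ->
  measurable B2 ->
  (P ((A1 `|` A2) `+` (B1 `|` B2)) <= P (A1 `+` B1) + P (A2 `+` B2))%E.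
Proof.
move=> mA1 mA2 mB1 mB2.
have ? := measurable_setY mA1 mB1; have ? := measurable_setY mA2 mB2.
apply: le_trans (measureU2 _ _ _) => //.
apply: le_measure; rewrite ?inE//.
- by apply: measurable_setY; exact: measurableU.
- exact: measurableU.
by move=> w; rewrite /setY /=; tauto.
Qed.

Lemma bigcup_approx (F : nat -> set W) (e : R) : (forall n, measurable (F n)) ->
  0 < e -> exists N, (P ((\bigcup_n F n) `+` (\big[setU/set0]_(i < N) F i)) <= e%:E)%E.
Proof.
move=> mF e0.
pose S N := \big[setU/set0]_(i < N.+1) F i.
have mS N : measurable (S N) by exact: bigsetU_measurable.
have SE : \bigcup_n F n = \bigcup_N S N.
  by rewrite bigcup_bigsetU_bigcup.
have mU : measurable (\bigcup_n F n) by exact: bigcupT_measurable.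
have cS : P \o S @ \oo --> P (\bigcup_n F n).
  rewrite SE; apply: nondecreasing_cvg_mu => //; first by rewrite -SE.
  by move=> n m nm; apply/subsetPset; exact: subset_bigsetU.
have fU : P (\bigcup_n F n) \is a fin_num by exact: fin_num_measure.
have lt : (P (\bigcup_n F n) - e%:E < P (\bigcup_n F n))%E.
  by rewrite lteBlDr// lteDl.
have [N _ /(_ N (leqnn _)) /= HN] := cS _ (open_ereal_gt' lt).
exists N.+1; rewrite -/(S N).
have SU : S N `<=` \bigcup_n F n.
  by rewrite SE; exact: bigcup_sup.
have -> : (\bigcup_n F n) `+` S N = (\bigcup_n F n) `\` S N.
  by rewrite /setY [X in _ `|` X](_ : _ = set0) ?setU0// setD_eq0.
rewrite measureD//; last by rewrite -ge0_fin_numE.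
rewrite (setIidr SU).
have fS : P (S N) \is a fin_num by exact: fin_num_measure.
move: HN; rewrite EFinN lteBlDr// => /ltW.
by rewrite leeBlDl.
Qed.

Lemma bigsetU_closed (K : set (set W)) (F : nat -> set W) N : K set0 ->
  (forall A B, K A -> K B -> K (A `|` B)) -> (forall n, K (F n)) ->
  K (\big[setU/set0]_(i < N) F i).
Proof.
by move=> K0 KU KF; elim: N => [|N IH]; rewrite ?big_ord0// big_ord_recr/=; exact: KU.
Qed.

(** A countable union is a limit, in the distance [P (A]+[B)], of its finite partial unions;
    closedness for this distance therefore upgrades an algebra to a sigma-algebra. Classes of sets
    defined by approximation are handled this way. *)
Lemma algebra_closed_sigma_algebra (K : set (set W)) :
  K `<=` measurable -> K set0 -> (forall A, K A -> K (~` A)) ->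
  (forall A B, K A -> K B -> K (A `|` B)) ->
  (forall A, measurable A -> (forall e : R, 0 < e ->
     exists2 B, K B & (P (A `+` B) <= e%:E)%E) -> K A) ->
  sigma_algebra [set: W] K.
Proof.
move=> Km K0 KC KU Kcl; split => //; first by move=> A KA; rewrite setTD; exact: KC.
move=> F KF; apply: Kcl => [|e e0].
  by apply: bigcupT_measurable => n; exact: Km.
have [N HN] := bigcup_approx (fun n => Km _ (KF n)) e0.
by exists (\big[setU/set0]_(i < N) F i) => //; exact: (@bigsetU_closed K F N).
Qed.

(** Completeness of the measure algebra of [K], with a rate. The limit is [lim_sup_set F]: a point
    outside all the sets [F k]+[F k.+1] with [k >= n] belongs to every [F k] with [k >= n] or to
    none, so [F n]+[E] is covered by these sets, whose measures sum to at most [1 / 2 ^ n]. *)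
Lemma measure_algebra_complete (K : set (set W)) (F : nat -> set W) :
  sigma_algebra [set: W] K -> K `<=` measurable -> (forall n, K (F n)) ->
  (forall n, (P (F n `+` F n.+1) <= (1 / (2 ^ n.+1)%:R)%:E)%E) ->
  exists2 E, K E & forall n, (P (F n `+` E) <= (1 / (2 ^ n)%:R)%:E)%E.
Proof.
move=> [K0 KC KU] Km KF dF.
have KU' (G : nat -> set W) : (forall n, K (G n)) -> K (\bigcup_n G n) by exact: KU.
have KI (G : nat -> set W) : (forall n, K (G n)) -> K (\bigcap_n G n).
  move=> KG; rewrite -[X in K X]setCK setC_bigcap -setTD; apply: (KC); apply: (KU) => n.
  by rewrite -setTD; exact: KC.
have KE : K (lim_sup_set F).
  apply: KI => n; rewrite bigcup_mkcond; apply: (KU) => k.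
  by case: ifPn.
exists (lim_sup_set F) => // n.
have mF k : measurable (F k) by exact: Km.
apply: (@le_trans _ _ (\sum_(0 <= k <oo) P (F (k + n)%N `+` F (k + n).+1))%E).
  apply: measure_sigma_subadditive => [k||].
  - exact: measurable_setY.
  - by apply: measurable_setY => //; exact: Km.
  move=> w Hw; apply: contrapT => Hn.
  have cst k : F (k + n)%N w <-> F n w.
    elim: k => [|k IH]; first by rewrite add0n.
    rewrite -IH addSn.
    case: (pselect (F (k + n)%N w)) => Fk; case: (pselect (F (k + n).+1 w)) => Fk1.
    - by [].
    - by exfalso; apply: Hn; exists k => //; left.
    - by exfalso; apply: Hn; exists k => //; right.
    - by [].
  have cst' m : (n <= m)%N -> F m w <-> F n w.
    by move=> nm; rewrite -(subnK nm).
  case: Hw => -[].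
  - move=> Fn; apply => m _; exists (maxn m n); first by rewrite /= leq_maxl.
    by apply/cst' => //; exact: leq_maxr.
  - by move=> /(_ n Logic.I) [m /= nm /cst' Fm] Fn; apply/Fn/Fm.
apply: le_trans; last first.
  have := @epsilon_trick0 R (1 / (2 ^ n)%:R) xpredT.
  by apply; rewrite divr_ge0.
apply: lee_nneseries => [k _ _|k _]; first exact: measure_ge0.
apply: le_trans (dF _) _; rewrite lee_fin -addSn expnD natrM.
by rewrite !div1r invfM mulrC.
Qed.

Lemma pow2_small (e : R) : 0 < e -> exists n, 1 / (2 ^ n)%:R <= e.
Proof.
move=> e0; have [n _ /(_ n (leqnn _)) /= /ltW] := near_infty_natSinv_expn_lt (PosNum e0).
by exists n; rewrite natrX.
Qed.

Definition mem_ae (K : set (set W)) E := exists2 F, K F & P (E `+` F) = 0%E.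

(** Members [F n] of [K] within [1 / 2 ^ (n + 2)] of [E] form a sequence with consecutive distances
    below [1 / 2 ^ (n + 1)]; its limit in [K] differs from [E] by a null set. *)
Lemma mem_ae_closed (K : set (set W)) E :
  sigma_algebra [set: W] K -> K `<=` measurable -> measurable E ->
  (forall e : R, 0 < e -> exists2 F, K F & (P (E `+` F) <= e%:E)%E) ->
  mem_ae K E.
Proof.
move=> sK Km mE HE.
have pos n : 0 < 1 / (2 ^ n)%:R :> R by rewrite divr_gt0// ltr0n expn_gt0.
have /choice [F HF] : forall n, exists F, K F /\ (P (E `+` F) <= (1 / (2 ^ n.+2)%:R)%:E)%E.
  by move=> n; have [F KF PF] := HE _ (pos n.+2); exists F.
have mF n : measurable (F n) by apply: Km; exact: (HF n).1.
have pow n : 1 / (2 ^ n.+1)%:R = 1 / (2 ^ n)%:R / 2 :> R.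
  by rewrite expnS natrM; field; rewrite pnatr_eq0 expn_eq0.
have [|G KG PG] := @measure_algebra_complete K F sK Km (fun n => (HF n).1).
  move=> n; apply: (@setY_triangle_le _ E _ (1 / (2 ^ n.+2)%:R) (1 / (2 ^ n.+3)%:R)) => //.
  - by rewrite !pow; have := pos n; lra.
  - by rewrite setYC; exact: (HF n).2.
  - exact: (HF n.+1).2.
exists G => //; apply: ge0_small_eq0; first exact: measure_ge0.
move=> e e0; have [n ne] := pow2_small e0.
have mG : measurable G by exact: Km.
apply: (@setY_triangle_le _ (F n.+1) _ (1 / (2 ^ n.+3)%:R) (1 / (2 ^ n.+1)%:R)) => //.
- by apply: le_trans ne; rewrite !pow; have := pos n; lra.
- exact: (HF n.+1).2.
Qed.

(** Allows an inclusion modulo null sets to be checked on generators only. *)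
Lemma mem_ae_sigma_algebra (K : set (set W)) :
  sigma_algebra [set: W] K -> K `<=` measurable ->
  sigma_algebra [set: W] [set E | measurable E /\ mem_ae K E].
Proof.
move=> sK Km; have [K0 KC KU] := sK.
have KU2 A B : K A -> K B -> K (A `|` B).
  move=> KA KB; rewrite -bigcup2E; apply: KU => n.
  by rewrite /bigcup2; case: n => [|[|n]].
apply: algebra_closed_sigma_algebra => /=.
- by move=> E [].
- by split => //; exists set0 => //; rewrite setYK measure0.
- move=> A [mA [F KF AF]]; split; first exact: measurableC.
  by exists (~` F); [rewrite -setTD; exact: KC|rewrite setY_complement].
- move=> A B [mA [F KF AF]] [mB [G KG BG]]; split; first exact: measurableU.
  exists (F `|` G); first exact: KU2.
  apply/eqP; rewrite eq_le measure_ge0 andbT.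
  have mF := Km _ KF; have mG := Km _ KG.
  by rewrite (le_trans (setYU mA mB mF mG))// AF BG adde0.
- move=> A mA HA; split => //; apply: mem_ae_closed => // e e0.
  have [B [mB [F KF BF]] AB] := HA _ e0; exists F => //.
  by apply: (@setY_triangle_le _ B _ e 0); rewrite ?addr0 ?BF//; exact: Km.
Qed.

End measure_algebra.

(** * Sets whose preimages converge along a sequence of maps *)

Section convergence_of_sets.
Context (R : realType) d (W : measurableType d) (P : probability W R)
  d' (W' : measurableType d') (Q : probability W' R).

Lemma mp_measurable (f : W -> W') E : measure_preserving P Q f -> measurable E ->
  measurable (f @^-1` E).
Proof. by move=> [mf _] mE; rewrite -[X in measurable X]setTI; exact: mf. Qed.

(** Two instances matter: [iter (q n) V] against the identity, which gives the sets rigid along [q],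
    and translates [hx x' \o S (g n)] of one fibre function against another fibre function
    [hx x]. *)
Definition converging_sets (a : nat -> W -> W') (b : W -> W') : set (set W') :=
  [set E | measurable E /\ forall e : R, 0 < e ->
    \forall n \near \oo, (P (a n @^-1` E `+` b @^-1` E) <= e%:E)%E].

(** As all maps preserve measure, the error made in replacing [E] by [B] is the same for every [n],
    so the threshold valid for [B] also serves [E]. *)
Lemma converging_sets_closed a b E : (forall n, measure_preserving P Q (a n)) ->
  measure_preserving P Q b -> measurable E ->
  (forall e : R, 0 < e ->
     exists2 B, converging_sets a b B & (Q (E `+` B) <= e%:E)%E) ->
  converging_sets a b E.
Proof.
move=> mpa mpb mE HE; split => // e e0.
have e4 : 0 < e / 4 by rewrite divr_gt0.
have [B [mB cB] EB] := HE _ e4.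
have maE n : measurable (a n @^-1` E) by exact: mp_measurable.
have maB n : measurable (a n @^-1` B) by exact: mp_measurable.
have mbE : measurable (b @^-1` E) by exact: mp_measurable.
have mbB : measurable (b @^-1` B) by exact: mp_measurable.
near=> n.
apply: (@setY_triangle_le _ _ _ _ _ (a n @^-1` B) _ (e / 4) (e / 4 + e / 4)) => //.
- by lra.
- rewrite -preimage_setY.
  by rewrite (mpa n).2//; exact: measurable_setY.
apply: (@setY_triangle_le _ _ _ _ _ (b @^-1` B) _ (e / 4) (e / 4)) => //.
- by near: n; exact: cB.
- rewrite setYC -preimage_setY.
  by rewrite mpb.2//; exact: measurable_setY.
Unshelve. all: by end_near. Qed.

Lemma converging_sets_sigma_algebra a b :
  (forall n, measure_preserving P Q (a n)) -> measure_preserving P Q b ->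
  sigma_algebra [set: W'] (converging_sets a b).
Proof.
move=> mpa mpb; apply: (algebra_closed_sigma_algebra (P := Q)).
- by move=> E [].
- split => // e e0; near=> n.
  by rewrite !preimage_set0 setYK measure0 lee_fin ltW.
- move=> A [mA cA]; split; first exact: measurableC.
  by move=> e e0; have := cA _ e0; apply: filterS => n; rewrite -!preimage_setC setY_complement.
- move=> A B [mA cA] [mB cB]; split; first exact: measurableU.
  move=> e e0; have e2 : 0 < e / 2 by rewrite divr_gt0.
  near=> n; rewrite !preimage_setU.
  apply: le_trans (setYU _ _ _ _ _) _; try exact: mp_measurable.
  rewrite [leRHS](_ : _ = (e / 2)%:E + (e / 2)%:E)%E; last by rewrite -EFinD; congr EFin; lra.
  by apply: leeD; near: n; [exact: cA|exact: cB].
- by move=> E mE HE; apply: converging_sets_closed.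
Unshelve. all: by end_near. Qed.

End convergence_of_sets.

(** * Coding sequences of sets by real functions *)

Section ternary_code.
Context (R : realType) (W : Type).
Implicit Types (D : nat -> set W) (w : W).

(** Base 3 with digits 0 and 2, as in the Cantor set: the first digit decides between values at most
    1/3 and values at least 2/3. Codes can thus be decoded at every point, without the ambiguity of
    binary expansions. The recursion shifts [D], so that the head digit is split off first. *)
Fixpoint ternary_sum (N : nat) D w : R :=
  if N is n.+1 then (2 * \1_(D 0%N) w + ternary_sum n (fun i => D i.+1) w) / 3
  else 0.

Definition ternary_code D w : R := limn (fun N => ternary_sum N D w).

Lemma ternary_sum01 N D w : 0 <= ternary_sum N D w <= 1.
Proof.
elim: N D => [|N IH] D /=; first by rewrite lexx ler01.
have /andP[h0 h1] := IH (fun i => D i.+1).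
by rewrite indicE; case: (w \in D 0%N); rewrite /=; apply/andP; split; lra.
Qed.

Lemma ternary_sum_ndecr D w : nondecreasing_seq (fun N => ternary_sum N D w).
Proof.
apply/nondecreasing_seqP => N; elim: N D => [|N IH] D.
  by have /andP[] := ternary_sum01 1 D w.
rewrite -[X in _ <= X]/((2 * \1_(D 0%N) w + ternary_sum N.+1 (fun i => D i.+1) w) / 3).
by rewrite /= ler_pM2r ?invr_gt0// lerD2l; exact: (IH (fun i => D i.+1)).
Qed.

Lemma ternary_sum_cvg D w : cvgn (fun N => ternary_sum N D w).
Proof.
apply: nondecreasing_is_cvgn; first exact: ternary_sum_ndecr.
by exists 1 => _ [N _ <-]; have /andP[] := ternary_sum01 N D w.
Qed.

Lemma ternary_sum_le_code N D w : ternary_sum N D w <= ternary_code D w.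
Proof.
apply: (nondecreasing_cvgn_le (u_ := fun N => ternary_sum N D w)).
  exact: ternary_sum_ndecr.
exact: ternary_sum_cvg.
Qed.

Lemma ternary_code01 D w : 0 <= ternary_code D w <= 1.
Proof.
apply/andP; split; first exact: (ternary_sum_le_code 0 D w).
apply: limr_le; first exact: ternary_sum_cvg.
by apply: nearW => N; have /andP[] := ternary_sum01 N D w.
Qed.

Lemma ternary_codeS D w :
  ternary_code D w = (2 * \1_(D 0%N) w + ternary_code (fun i => D i.+1) w) / 3.
Proof.
apply/cvg_lim => //; rewrite -cvg_shiftS /=.
apply: cvgMr_tmp; apply: cvgD; first exact: cvg_cst.
exact: ternary_sum_cvg.
Qed.

(** The code is the supremum of its partial sums, and a partial sum is compared with [a] by
    splitting on the first digit, which turns the threshold [a] into [3 * a - 2] or [3 * a]. The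
    sigma-algebra [K] is arbitrary because the rigid sets, and not only the measurable ones, have to
    be stable under coding. *)
Lemma ternary_code_gt D (a : R) (K : set (set W)) :
  sigma_algebra [set: W] K -> (forall i, K (D i)) ->
  K [set w | a < ternary_code D w].
Proof.
move=> sK KD; have [K0 KC KU] := sK.
have KC' A : K A -> K (~` A) by move=> KA; rewrite -setTD; exact: KC.
have KU2 A B : K A -> K B -> K (A `|` B).
  by move=> KA KB; rewrite -bigcup2E; apply: KU => -[|[|n]].
have KI2 A B : K A -> K B -> K (A `&` B) by exact: sigma_algebra_setI.
rewrite (_ : [set _ | _] = \bigcup_N [set w | a < ternary_sum N D w]); last first.
  apply/seteqP; split => w /=; last first.
    by move=> [N _ /= /lt_le_trans]; apply; exact: ternary_sum_le_code.
  move=> aw; apply: contrapT => H.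
  have : ternary_code D w <= a.
    apply: limr_le; first exact: ternary_sum_cvg.
    apply: nearW => N; rewrite leNgt; apply/negP => aN; apply: H.
    by exists N.
  by rewrite leNgt aw.
apply: (KU) => N; elim: N D a KD => [|N IH] D a KD.
  rewrite (_ : [set _ | _] = if a < 0 then setT else set0).
    by case: ifP => // _; rewrite -(setC0); exact: KC'.
  by case: ifP => a0; apply/seteqP; split => w //=; rewrite a0.
rewrite (_ : [set _ | _] =
    (D 0%N `&` [set w | 3 * a - 2 < ternary_sum N (fun i => D i.+1) w]) `|`
    (~` D 0%N `&` [set w | 3 * a < ternary_sum N (fun i => D i.+1) w])).
  by apply: (KU2); apply: (KI2) => //; [exact: IH|exact: KC'|exact: IH].
apply/seteqP; split => w /=.
  rewrite indicE; case: (pselect (D 0%N w)) => Dw.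
    by rewrite mem_set// => H; left; split => //=; move: H; rewrite /=; lra.
  by rewrite memNset// => H; right; split => //=; move: H; rewrite /=; lra.
rewrite indicE => -[[Dw]|[Dw]].
  by rewrite mem_set//= => H; lra.
by rewrite memNset//= => H; lra.
Qed.

End ternary_code.

(** The points may lie in different spaces: matching digits of [V w] and of [h w] is what yields
    equations such as [h (V w) = U (h w)]. *)
Lemma eq_ternary_code (R : realType) (W W' : Type) (D : nat -> set W)
    (D' : nat -> set W') w w' : (forall i, D i w <-> D' i w') ->
  ternary_code R D w = ternary_code R D' w'.
Proof.
move=> DD'; rewrite /ternary_code; congr (limn _); apply/funext => N.
elim: N D D' DD' => //= N IH D D' DD'; congr ((2 * _ + _) / 3).
  rewrite !indicE; congr (_%:R); congr nat_of_bool.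
  by apply/idP/idP; rewrite !inE => /DD'.
exact: IH.
Qed.

Section ternary_code_measurable.
Context (R : realType).

Lemma preimage_sigma_algebra_R (W : Type) (K : set (set W)) (f : W -> R) :
  sigma_algebra [set: W] K -> (forall a, K [set w | a < f w]) ->
  forall E : set R, measurable E -> K (f @^-1` E).
Proof.
move=> sK KH E mE.
have {}mE : (@RGenOInfty.G R).-sigma.-measurable E.
  by rewrite -RGenOInfty.measurableE; exact: mE.
apply: (sigma_generated_ind (sigma_algebra_preim f sK)) mE.
move=> _ [a ->] /=.
rewrite (_ : _ @^-1` _ = [set w | a < f w]); first exact: KH.
by apply/seteqP; split => w /=; rewrite in_itv/= andbT.
Qed.

Lemma preimage_ternary_code (W : Type) (K : set (set W)) (D : nat -> set W) :
  sigma_algebra [set: W] K -> (forall i, K (D i)) ->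
  forall E : set R, measurable E -> K (ternary_code R D @^-1` E).
Proof.
move=> sK KD; apply: preimage_sigma_algebra_R => // a.
exact: ternary_code_gt.
Qed.

Lemma measurable_ternary_code d (W : measurableType d) (D : nat -> set W) :
  (forall i, measurable (D i)) -> measurable_fun [set: W] (ternary_code R D).
Proof.
move=> mD _ E mE; rewrite setTI; apply: preimage_ternary_code mE => //.
exact: sigma_algebra_measurable.
Qed.

(** The threshold 1/2 lies in the gap between the two possible first digits, and [g] removes the
    first digit, so [G i] reads digit number [i]. The sets [G i] depend neither on the space nor on
    the coded sequence. *)
Lemma ternary_decode : exists G : nat -> set R, (forall i, measurable (G i)) /\
  forall (W : Type) (D : nat -> set W) i, ternary_code R D @^-1` G i = D i.
Proof.
pose H := [set t : R | 1 / 2 < t].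
have mH : measurable H.
  rewrite (_ : H = `]1 / 2, +oo[%classic) //.
  by apply/seteqP; split => t /=; rewrite in_itv/= andbT.
pose g (t : R) : R := 3 * t - 2 * \1_H t.
have mg : measurable_fun setT g.
  by apply: measurable_funB; apply: measurable_funM => //; exact: measurable_indic.
pose G := fix G i := if i is n.+1 then g @^-1` G n else H.
exists G; split.
  elim=> [//|n IH] /=; rewrite -[X in measurable X]setTI; exact: mg.
move=> W D i; elim: i W D => [|i IH] W D.
  apply/seteqP; split => w /=; rewrite /H /= ternary_codeS indicE.
    apply: contraPP => Dw; rewrite memNset//=.
    have /andP[] := ternary_code01 R (fun i => D i.+1) w.
    by move=> ? ?; apply/negP; rewrite -leNgt; lra.
  move=> Dw; rewrite mem_set//=.
  by have /andP[] := ternary_code01 R (fun i => D i.+1) w; lra.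
have -> : ternary_code R D @^-1` G i.+1 = ternary_code R (fun i => D i.+1) @^-1` G i.
  apply/seteqP; suff E w : g (ternary_code R D w) = ternary_code R (fun i => D i.+1) w.
    by split => w /=; rewrite E.
  rewrite /g ternary_codeS !indicE.
  have /andP[c0 c1] := ternary_code01 R (fun i => D i.+1) w.
  case: (pselect (D 0%N w)) => Dw.
    rewrite (mem_set Dw) mem_set /H /=; lra.
  rewrite (memNset Dw) memNset /H /=; last by apply/negP; rewrite -leNgt; lra.
  lra.
exact: IH.
Qed.

End ternary_code_measurable.

(** * Separability *)

Lemma second_countable_seq (T : topologicalType) : @second_countable T ->
  exists e : nat -> set T, (forall n, open (e n)) /\
    forall U x, open U -> U x -> exists n, e n x /\ e n `<=` U.
Proof.
move=> [B /countable_injP [f fI] [Bo Bb]].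
(* The injection [f] numbers the base. The union has at most one member, and it is empty when [n] is
   not the number of a basic set. *)
exists (fun n => \bigcup_(U in B `&` [set U | f U = n]) U); split.
  by move=> n; apply: bigcup_open => U [BU _]; exact: Bo.
move=> U x oU Ux.
have [V [BV Vx] VU] := Bb x U (open_nbhs_nbhs (conj oU Ux)).
exists (f V); split; first by exists V.
move=> y [V' [BV' fV'] V'y]; apply: VU.
by have <- : V' = V by apply: fI; rewrite ?inE.
Qed.

Definition countably_generated d (W : measurableType d) := exists B : nat -> set W,
  (forall n, measurable (B n)) /\ forall E, measurable E -> <<s range B >> E.

(** Every open set is the union of those members of a countable base that it contains, so the
    preimages of the base generate. *)
Lemma standard_borel_countably_generated (R : realType) d (W : measurableType d) :
  standard_borel R W -> countably_generated W.
Proof.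
move=> [M [f [_ /second_countable_seq[e [eo eb]] _ mE]]].
exists (fun n => f @^-1` e n); split.
  by move=> n; rewrite mE; exists (e n); [exact: sub_sigma_algebra|rewrite setTI].
move=> E; rewrite mE => -[U sU <-]; rewrite setTI.
have := sigma_generated_ind (sigma_algebra_preim f (smallest_sigma_algebra setT
  (range (fun n => f @^-1` e n)))); apply; last exact: sU.
move=> V oV /=.
have -> : V = \bigcup_(n in [set n | e n `<=` V]) e n.
  apply/seteqP; split => [x Vx|x [n eV /eV]//].
  by have [n [enx enV]] := eb _ _ oV Vx; exists n.
have [_ _ KU] := smallest_sigma_algebra [set: W] (range (fun n => f @^-1` e n)).
have [K0 _ _] := smallest_sigma_algebra [set: W] (range (fun n => f @^-1` e n)).
rewrite preimage_bigcup bigcup_mkcond; apply: KU => n.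
by case: ifPn => // _; apply: sub_sigma_algebra; exists n.
Qed.

Lemma countably_generated_prod d1 d2 (W1 : measurableType d1)
    (W2 : measurableType d2) : countably_generated W1 -> countably_generated W2 ->
  countably_generated (W1 * W2)%type.
Proof.
move=> [B1 [mB1 gB1]] [B2 [mB2 gB2]].
pose B n := if odd n then B1 n./2 `*` [set: W2] else [set: W1] `*` B2 n./2.
exists B; split.
  by move=> n; rewrite /B; case: ifP => _; apply: measurableX.
have sK := smallest_sigma_algebra [set: (W1 * W2)%type] (range B).
have [K0 KC KU] := sK.
have B1' A : measurable A -> <<s range B >> (A `*` [set: W2]).
  move=> /gB1 gA; rewrite (_ : _ `*` _ = fst @^-1` A); last first.
    by apply/seteqP; split => -[x y] //= [].
  have := sigma_generated_ind (sigma_algebra_preim fst sK); apply; last exact: gA.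
  move=> _ [n _ <-] /=; apply: sub_sigma_algebra; exists (n.*2.+1) => //.
  rewrite /B /= odd_double /= uphalf_double.
  by apply/seteqP; split => -[x y] //= [].
have B2' A : measurable A -> <<s range B >> ([set: W1] `*` A).
  move=> /gB2 gA; rewrite (_ : _ `*` _ = snd @^-1` A); last first.
    by apply/seteqP; split => -[x y] //= [].
  have := sigma_generated_ind (sigma_algebra_preim snd sK); apply; last exact: gA.
  move=> _ [n _ <-] /=; apply: sub_sigma_algebra; exists (n.*2) => //.
  rewrite /B /= odd_double doubleK.
  by apply/seteqP; split => -[x y] //= [].
rewrite measurable_prod_measurableType => E.
apply: sigma_generated_ind => // _ [A1 mA1 [A2 mA2 <-]].
rewrite (_ : A1 `*` A2 = (A1 `*` [set: W2]) `&` ([set: W1] `*` A2)); last first.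
  by apply/seteqP; split => -[x y] //=; tauto.
by apply: (sigma_algebra_setI sK); [exact: B1'|exact: B2'].
Qed.

(** Names for the members of the algebra generated by a sequence of sets. The translation to
    [GenTree.tree nat] makes this algebra countable by lending its [pickle]. *)
Inductive bool_expr := BVar of nat | BNot of bool_expr | BOr of bool_expr & bool_expr.

Fixpoint bool_expr_tree (t : bool_expr) : GenTree.tree nat :=
  match t with
  | BVar n => GenTree.Leaf n
  | BNot t => GenTree.Node 0 [:: bool_expr_tree t]
  | BOr t u => GenTree.Node 1 [:: bool_expr_tree t; bool_expr_tree u]
  end.

Fixpoint tree_bool_expr (t : GenTree.tree nat) : option bool_expr :=
  match t with
  | GenTree.Leaf n => Some (BVar n)
  | GenTree.Node _ [:: t] => omap BNot (tree_bool_expr t)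
  | GenTree.Node _ [:: t; u] =>
      if tree_bool_expr t is Some t' then omap (BOr t') (tree_bool_expr u) else None
  | _ => None
  end.

Lemma bool_expr_treeK : pcancel bool_expr_tree tree_bool_expr.
Proof. by elim=> [|t /= ->|t /= -> u /= ->]. Qed.

Fixpoint bool_expr_eval (W : Type) (B : nat -> set W) (t : bool_expr) : set W :=
  match t with
  | BVar n => B n
  | BNot t => ~` bool_expr_eval B t
  | BOr t u => bool_expr_eval B t `|` bool_expr_eval B u
  end.

(** The countable algebra generated by the [B n] is dense: the sets that it approximates form a
    sigma-algebra by [algebra_closed_sigma_algebra]. *)
Lemma countably_generated_separable (R : realType) d (W : measurableType d)
    (P : probability W R) : countably_generated W ->
  exists m : nat -> set W, (forall n, measurable (m n)) /\
    forall E, measurable E -> forall e : R, 0 < e ->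
      exists n, (P (E `+` m n) <= e%:E)%E.
Proof.
move=> [B [mB gB]].
have mev t : measurable (bool_expr_eval B t).
  by elim: t => [n|t mt|t mt u mu] /=; [exact: mB|exact: measurableC|exact: measurableU].
pose m n := oapp (bool_expr_eval B) set0 (obind tree_bool_expr (unpickle n)).
have mpick t : m (pickle (bool_expr_tree t)) = bool_expr_eval B t.
  by rewrite /m pickleK /= bool_expr_treeK.
exists m; split.
  by move=> n; rewrite /m; case: obind => //=; exact: measurable0.
suff H : measurable `<=` [set E | measurable E /\ forall e : R, 0 < e ->
    exists t, (P (E `+` bool_expr_eval B t) <= e%:E)%E].
  move=> E /H[_ HE] e /HE[t Pt]; exists (pickle (bool_expr_tree t)).
  by rewrite mpick.
move=> E /gB; apply: sigma_generated_ind; last first.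
  move=> _ [n _ <-]; split => // e e0; exists (BVar n).
  by rewrite setYK measure0 lee_fin ltW.
apply: (algebra_closed_sigma_algebra (P := P)).
- by move=> A [].
- split => // e e0; exists (BNot (BOr (BVar 0) (BNot (BVar 0)))).
  by rewrite /= setUv setCT setYK measure0 lee_fin ltW.
- move=> A [mA HA]; split; first exact: measurableC.
  by move=> e /HA[t Pt]; exists (BNot t); rewrite /= setY_complement.
- move=> A C [mA HA] [mC HC]; split; first exact: measurableU.
  move=> e e0; have e2 : 0 < e / 2 by rewrite divr_gt0.
  have [t Pt] := HA _ e2; have [u Pu] := HC _ e2; exists (BOr t u).
  apply: le_trans (setYU _ _ _ _ _) _ => //.
  by rewrite [leRHS](_ : _ = (e / 2)%:E + (e / 2)%:E)%E ?leeD// -EFinD; congr EFin; lra.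
- move=> A mA HA; split => // e e0; have e2 : 0 < e / 2 by rewrite divr_gt0.
  have [C [mC HC] AC] := HA _ e2; have [t Ct] := HC _ e2; exists t.
  by apply: (setY_triangle_le (a := e / 2) (b := e / 2)) AC Ct => //; lra.
Qed.

(** A subset of a separable metric space is separable. The dense sequence must lie in [K], so for
    each dense point [m n] and radius [1 / 2 ^ k] a member of [K] in that ball is chosen when there
    is one, and [A0] otherwise. *)
Lemma separable_class (R : realType) d (W : measurableType d)
    (P : probability W R) (K : set (set W)) : countably_generated W ->
  K !=set0 -> K `<=` measurable ->
  exists D : nat -> set W, (forall n, K (D n)) /\
    forall E, K E -> forall e : R, 0 < e -> exists n, (P (E `+` D n) <= e%:E)%E.
Proof.
move=> cW [A0 KA0] Km; have [m [mm dm]] := countably_generated_separable P cW.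
have ex (nk : nat * nat) : exists A, K A /\ ((exists2 E, K E &
    (P (E `+` m nk.1) <= (1 / (2 ^ nk.2)%:R)%:E)%E) ->
    (P (A `+` m nk.1) <= (1 / (2 ^ nk.2)%:R)%:E)%E).
  have [[E KE PE]|nE] := pselect (exists2 E, K E &
    (P (E `+` m nk.1) <= (1 / (2 ^ nk.2)%:R)%:E)%E); first by exists E.
  by exists A0.
have [D HD] := choice ex.
exists (fun n => D (odflt (0, 0)%N (unpickle n))); split; first by move=> n; exact: (HD _).1.
move=> E KE e e0; have [k ke] := @pow2_small R _ (divr_gt0 e0 (@ltr0Sn R 1)).
have pk : 0 < 1 / (2 ^ k)%:R :> R by rewrite divr_gt0// ltr0n expn_gt0.
have [n En] := dm _ (Km _ KE) _ pk.
exists (pickle (n, k)); rewrite pickleK /=.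
have Dn := (HD (n, k)).2 (ex_intro2 _ _ E KE En).
have mD := Km _ (HD (n, k)).1.
apply: (setY_triangle_le (a := e / 2) (b := e / 2) (B := m n)) => //.
- exact: Km.
- by lra.
- by apply: (le_trans En); rewrite lee_fin.
- by rewrite setYC; apply: (le_trans Dn); rewrite lee_fin.
Qed.

(** A dense sequence of [K] consists of preimages under its own code, by decoding; the sets that
    agree modulo null sets with such a preimage are closed under approximation, so they exhaust
    [K]. *)
Lemma sigma_algebra_coded (R : realType) d (W : measurableType d)
    (P : probability W R) (K : set (set W)) : countably_generated W ->
  sigma_algebra [set: W] K -> K `<=` measurable ->
  exists D : nat -> set W, (forall n, K (D n)) /\
    forall E, K E -> exists2 F : set R, measurable F &
      P (E `+` ternary_code R D @^-1` F) = 0%E.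
Proof.
move=> cW sK Km; have [K0 _ _] := sK.
have [D [KD dD]] := separable_class P cW (ex_intro _ _ K0) Km.
exists D; split => // E KE.
have [G [mG HG]] := ternary_decode R.
pose L := preimage_set_system [set: W] (ternary_code R D) measurable.
have sL : sigma_algebra [set: W] L.
  exact: sigma_algebra_preimage (sigma_algebra_measurable _).
have Lm : L `<=` measurable.
  move=> _ [F mF <-]; apply: measurable_ternary_code => // n; exact: Km.
have : mem_ae P L E.
  apply: mem_ae_closed => //; first exact: Km.
  move=> e e0; have [n En] := dD _ KE _ e0.
  by exists (D n) => //; exists (G n) => //; rewrite setTI HG.
by move=> [_ [F mF <-]]; rewrite setTI => EF; exists F.
Qed.

Lemma ge0_cvge0 (R : realType) (x : nat -> \bar R) : (forall n, (0 <= x n)%E) ->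
  (forall e : R, 0 < e -> \forall n \near \oo, (x n <= e%:E)%E) ->
  x n @[n --> \oo] --> 0%E.
Proof.
move=> x0 xe; apply/fine_cvgP; split.
  have := xe _ ltr01; apply: filterS => n xn.
  by rewrite ge0_fin_numE// (le_lt_trans xn)// ltry.
apply/cvgrPdist_le => e e0; have := xe _ e0; apply: filterS => n xn.
have fx : x n \is a fin_num by rewrite ge0_fin_numE// (le_lt_trans xn)// ltry.
by rewrite sub0r normrN ger0_norm ?fine_ge0// -lee_fin fineK.
Qed.

Lemma cvge0_small (R : realType) (x : nat -> \bar R) :
  x n @[n --> \oo] --> 0%E -> forall e : R, 0 < e ->
  \forall n \near \oo, (x n <= e%:E)%E.
Proof.
move=> /fine_cvgP[fx /cvgrPdist_le x0] e e0.
near=> n; have fn : x n \is a fin_num by near: n.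
rewrite -(fineK fn) lee_fin; apply: le_trans (ler_norm _) _.
by rewrite -normrN -sub0r; near: n; exact: x0.
Unshelve. all: by end_near. Qed.

(** * Almost everywhere statements and L1 distances *)

Section almost_everywhere.
Context (R : realType) d (W : measurableType d) (P : probability W R).

Lemma setY0_ae (A B : set W) : measurable A -> measurable B ->
  P (A `+` B) = 0%E -> \forall w \ae P, A w <-> B w.
Proof.
move=> mA mB AB; exists (A `+` B); split => //; first exact: measurable_setY.
by move=> w /=; rewrite /setY /=; case: (pselect (A w)); case: (pselect (B w)); tauto.
Qed.

Lemma ae_setY0 (A B : set W) : measurable A -> measurable B ->
  (\forall w \ae P, A w <-> B w) -> P (A `+` B) = 0%E.
Proof.
move=> mA mB [N [mN N0 ABN]]; apply: subset_measure0 N0 => //.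
  exact: measurable_setY.
by move=> w; rewrite /setY /= => H; apply: ABN => /=; tauto.
Qed.

Lemma ae_full (A : set W) : measurable A -> (\forall w \ae P, A w) -> P A = 1%E.
Proof.
move=> mA aA; rewrite -(@probability_setT _ _ _ P); apply: setY0_measure => //.
by apply: ae_setY0 => //; apply: filterS aA.
Qed.

Lemma full_ae (A : set W) : measurable A -> P A = 1%E -> \forall w \ae P, A w.
Proof.
move=> mA A1; exists (~` A); split => //; first exact: measurableC.
by rewrite probability_setC// A1 subee.
Qed.

Lemma ae_nonempty (p : W -> Prop) : (\forall w \ae P, p w) -> exists w, p w.
Proof.
move=> [N [mN N0 pN]]; apply: contrapT => np.
have NT : N = setT.
  by apply/seteqP; split => // w _; apply: pN => pw; apply: np; exists w.
by move: N0; rewrite NT probability_setT => /eqP; rewrite onee_eq0.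
Qed.

End almost_everywhere.

Section ae_preimage.
Context (R : realType) d (W : measurableType d) (P : probability W R)
  d' (W' : measurableType d') (Q : probability W' R).

Lemma mp_ae (f : W -> W') (p : W' -> Prop) : measure_preserving P Q f ->
  (\forall w \ae Q, p w) -> \forall w \ae P, p (f w).
Proof.
move=> mpf [N [mN N0 pN]]; exists (f @^-1` N); split.
- exact: mp_measurable mpf mN.
- by rewrite mpf.2.
- by move=> w np; exact: pN.
Qed.

(** Descends an identity checked on the values of [f] to an almost everywhere identity for the law
    of [f]. *)
Lemma mp_aeV (f : W -> W') (A : set W') : measure_preserving P Q f ->
  measurable A -> (\forall w \ae P, A (f w)) -> \forall w \ae Q, A w.
Proof.
move=> mpf mA aA; apply: full_ae => //.
by rewrite -mpf.2//; apply: ae_full => //; exact: mp_measurable mpf mA.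
Qed.

End ae_preimage.

Lemma measure_preserving_comp (R : realType) d1 d2 d3 (W1 : measurableType d1)
    (W2 : measurableType d2) (W3 : measurableType d3) (P1 : probability W1 R)
    (P2 : probability W2 R) (P3 : probability W3 R) (f : W1 -> W2) (g : W2 -> W3) :
  measure_preserving P1 P2 f -> measure_preserving P2 P3 g ->
  measure_preserving P1 P3 (g \o f).
Proof.
move=> mpf mpg; split; first exact: measurableT_comp mpg.1 mpf.1.
by move=> E mE; rewrite comp_preimage mpf.2 ?mpg.2//; exact: mp_measurable mpg mE.
Qed.

Lemma measure_preserving_id (R : realType) d (W : measurableType d)
  (P : probability W R) : measure_preserving P P id.
Proof. by split => //; exact: measurable_id. Qed.

Lemma measure_preserving_iter (R : realType) d (W : measurableType d)
    (P : probability W R) (V : W -> W) n :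
  measure_preserving P P V -> measure_preserving P P (iter n V).
Proof.
move=> mpV; elim: n => [|n IH]; first exact: measure_preserving_id.
exact: measure_preserving_comp IH mpV.
Qed.

Lemma image_probability (R : realType) d d' (W : measurableType d)
    (W' : measurableType d') (P : probability W R) (f : W -> W') :
  measurable_fun [set: W] f ->
  exists Q : probability W' R, measure_preserving P Q f.
Proof.
move=> mf; exists (distribution P (mfun_Sub (mem_set mf))).
by split => // E mE; rewrite /distribution/= /pushforward.
Qed.

Section L1_distance.
Context (R : realType) d (W : measurableType d) (P : probability W R).
Implicit Types u v w : W -> R.

Definition L1dist u v : \bar R := (\int[P]_x `|u x - v x|%:E)%E.

Lemma L1dist_ge0 u v : (0 <= L1dist u v)%E.
Proof. by apply: integral_ge0 => x _; rewrite lee_fin. Qed.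

Lemma L1distC u v : L1dist u v = L1dist v u.
Proof. by apply: eq_integral => x _; rewrite distrC. Qed.

Lemma measurable_dist u v : measurable_fun setT u -> measurable_fun setT v ->
  measurable_fun setT (fun x => `|u x - v x|%:E).
Proof.
by move=> mu mv; apply/measurable_EFinP; apply: measurableT_comp => //;
  exact: measurable_funB.
Qed.

Lemma L1dist_triangle u v w : measurable_fun setT u -> measurable_fun setT v ->
  measurable_fun setT w -> (L1dist u w <= L1dist u v + L1dist v w)%E.
Proof.
move=> mu mv mw; rewrite -ge0_integralD//; try exact: measurable_dist;
  try by move=> x _; rewrite lee_fin.
apply: ge0_le_integral => //; try exact: measurable_dist.
- by apply: emeasurable_funD; exact: measurable_dist.
- by move=> x _; rewrite -EFinD lee_fin ler_distD.
Qed.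

Lemma markov_L1dist u v (a b : R) : measurable_fun setT u -> measurable_fun setT v ->
  0 < a -> (L1dist u v <= (a * b)%:E)%E ->
  (P [set x | (a <= `|u x - v x|)%R] <= b%:E)%E.
Proof.
move=> mu mv a0 H.
have mA : measurable [set x | a <= `|u x - v x|].
  rewrite -[X in measurable X]setTI.
  apply: measurable_fun_le => //.
  by apply: measurableT_comp => //; exact: measurable_funB.
rewrite -(lee_pmul2l _ (_ : 0 < a%:E)%E)// -EFinM; apply: le_trans H.
rewrite -[X in (_ * P X)%E]setIT -integral_indic// -ge0_integralZl//; last 2 first.
- by apply/measurable_EFinP; exact: measurable_indic.
- by rewrite lee_fin ltW.
apply: ge0_le_integral => //.
- by move=> x _; rewrite -EFinM lee_fin mulr_ge0// ltW.
- by apply: measurable_funeM; apply/measurable_EFinP; exact: measurable_indic.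
- exact: measurable_dist.
move=> x _; rewrite -EFinM lee_fin indicE; case: (pselect (a <= `|u x - v x|)) => ax.
  by rewrite mem_set// mulr1.
by rewrite memNset// mulr0.
Qed.

(** Cut [0, 1] into slices [I k] of length [1 / M]. Outside the small set [B n] both functions take
    values in the same slice, so they differ by at most [1 / M]; on [B n] they differ by at most
    1. *)
Lemma converging_sets_L1 (vn : nat -> W -> R) (v : W -> R) :
  (forall n, measurable_fun setT (vn n)) -> measurable_fun setT v ->
  (forall n x, 0 <= vn n x <= 1) -> (forall x, 0 <= v x <= 1) ->
  (forall E, measurable E -> converging_sets P vn v E) ->
  forall e : R, 0 < e -> \forall n \near \oo, (L1dist (vn n) v <= e%:E)%E.
Proof.
move=> mvn mv vn01 v01 cv e e0.
have [N Ne] := pow2_small (divr_gt0 e0 (@ltr0Sn R 1)).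
set M := (2 ^ N)%N in Ne.
have M0 : 0 < M%:R :> R by rewrite ltr0n expn_gt0.
pose I k := [set s : R | k%:R / M%:R <= s < k.+1%:R / M%:R].
have mI k : measurable (I k).
  have -> : I k = `[k%:R / M%:R, k.+1%:R / M%:R[%classic.
    by apply/seteqP; split => s /=; rewrite in_itv.
  exact: measurable_itv.
(* The slices are half-open, so the value 1 falls into slice number [M], which makes [M.+1]
   slices. *)
pose B n := \big[setU/set0]_(k < M.+1) (vn n @^-1` I k `+` v @^-1` I k).
have mvI n k : measurable (vn n @^-1` I k) by rewrite -[X in measurable X]setTI; exact: mvn.
have mvI' k : measurable (v @^-1` I k) by rewrite -[X in measurable X]setTI; exact: mv.
have mB n : measurable (B n).
  by apply: bigsetU_measurable => k _; exact: measurable_setY.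
have PB : \forall n \near \oo, (P (B n) <= (e / 2)%:E)%E.
  have e2 : 0 < e / 2 / M.+1%:R by rewrite divr_gt0// divr_gt0.
  have : \forall n \near \oo, forall k : 'I_M.+1,
      (P (vn n @^-1` I k `+` v @^-1` I k) <= (e / 2 / M.+1%:R)%:E)%E.
    by apply: filter_forall => k; exact: (cv _ (mI k)).2.
  apply: filterS => n Hn.
  apply: le_trans (content_subadditive P (F := fun k => vn n @^-1` I k `+` v @^-1` I k)
    (n := M.+1) _ (mB n) _) _ => //.
    by move=> k _; exact: measurable_setY.
  apply: (@le_trans _ _ (\sum_(k < M.+1) (e / 2 / M.+1%:R)%:E)%E).
    by apply: lee_sum => k _; exact: Hn.
  rewrite sumEFin lee_fin sumr_const card_ord -[X in X <= _]mulr_natr divfK// pnatr_eq0//.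
apply: filterS PB => n PB.
have key x : `|vn n x - v x| <= 1 / M%:R + \1_(B n) x.
  have [Bx|nBx] := pselect (B n x).
    rewrite indicE mem_set//=.
    have /andP[? ?] := vn01 n x; have /andP[? ?] := v01 x.
    have : 0 < 1 / M%:R :> R by rewrite divr_gt0.
    by rewrite ler_norml => ?; apply/andP; split; lra.
  rewrite indicE memNset//= addr0.
  have /andP[v0 v1] := v01 x.
  set k := Num.trunc (M%:R * v x).
  have /andP[k1 k2] := truncn_itv (mulr_ge0 (ltW M0) v0).
  have Ik : I k (v x) by rewrite /I /= ler_pdivrMr// ltr_pdivlMr// !(mulrC (v x)) k1 k2.
  have kM : (k < M.+1)%N.
    by rewrite ltnS -(@ler_nat R) (le_trans k1)// ler_piMr// ltW.
  have Ik' : I k (vn n x).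
    apply: contrapT => nI; apply: nBx.
    rewrite /B -(bigcup_mkord M.+1 (fun k => vn n @^-1` I k `+` v @^-1` I k)).
    by exists k => //; right.
  move: Ik Ik'; rewrite /I /= -[in X in _ <= _ < X]natr1 mulrDl.
  move=> /andP[? ?] /andP[? ?]; rewrite ler_norml; apply/andP; split; lra.
apply: (@le_trans _ _ (\int[P]_x ((1 / M%:R)%:E + (\1_(B n) x)%:E))%E).
  apply: ge0_le_integral => //.
  - exact: measurable_dist.
  - by apply: emeasurable_funD => //; apply/measurable_EFinP; exact: measurable_indic.
  - by move=> x _; rewrite -EFinD lee_fin.
rewrite ge0_integralD//; last by apply/measurable_EFinP; exact: measurable_indic.
rewrite integral_indic// setIT [X in (X + _)%E](_ : _ = (1 / M%:R)%:E); last first.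
  by rewrite (integral_cst P measurableT) -[RHS]mule1 -(probability_setT P).
rewrite [leRHS](_ : _ = (e / 2)%:E + (e / 2)%:E)%E; last by rewrite -EFinD; congr EFin; lra.
by rewrite leeD.
Qed.

End L1_distance.

Lemma ge0_integral_mp (R : realType) d d' (W : measurableType d)
    (W' : measurableType d') (P : probability W R) (Q : probability W' R)
    (f : W -> W') (u : W' -> \bar R) : measure_preserving P Q f ->
  measurable_fun setT u -> (forall x, (0 <= u x)%E) ->
  (\int[P]_x u (f x) = \int[Q]_x u x)%E.
Proof.
move=> [mf Pf] mu u0.
have := @ge0_integral_pushforward _ _ _ _ R f mf P setT u measurableT mu.
rewrite preimage_setT => <- //.
by apply: eq_measure_integral => A mA _; rewrite /= /pushforward -Pf.
Qed.

Lemma L1dist_comp (R : realType) d d' (W : measurableType d)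
    (W' : measurableType d') (P : probability W R) (Q : probability W' R)
    (f : W -> W') (u v : W' -> R) :
  measure_preserving P Q f -> measurable_fun setT u -> measurable_fun setT v ->
  L1dist P (u \o f) (v \o f) = L1dist Q u v.
Proof.
move=> mpf mu mv.
rewrite /L1dist -(ge0_integral_mp mpf (u := fun x => `|u x - v x|%:E))//.
exact: measurable_dist.
Qed.

(** * From rigid sets to rigidity in L2 *)

Section L2_convergence.
Context (R : realType) d (W : measurableType d) (P : probability W R).

Lemma Lnorm2E (h : W -> R) :
  ('N[P]_2%:E[EFin \o h] = sqrte (\int[P]_x (h x ^+ 2)%:E))%E.
Proof.
rewrite unlock.
rewrite (_ : (fun x => `|(EFin \o h) x| `^ 2)%E = (fun x => (h x ^+ 2)%:E)); last first.
  by apply/funext => x; rewrite /= powR_mulrn// real_normK// num_real.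
rewrite poweR12_sqrt//; apply: integral_ge0 => x _.
by rewrite lee_fin sqr_ge0.
Qed.

Lemma Lnorm2_le (h : W -> R) (e : R) : 0 <= e ->
  (\int[P]_x (h x ^+ 2)%:E <= (e ^+ 2)%:E)%E -> ('N[P]_2%:E[EFin \o h] <= e%:E)%E.
Proof.
move=> e0 H; rewrite Lnorm2E.
have -> : e%:E = sqrte (e ^+ 2)%:E by rewrite /= sqrtr_sqr ger0_norm.
by rewrite lee_sqrt// lee_fin sqr_ge0.
Qed.

Lemma le_Lnorm2 (h : W -> R) (e : R) : 0 <= e ->
  ('N[P]_2%:E[EFin \o h] <= e%:E)%E -> (\int[P]_x (h x ^+ 2)%:E <= (e ^+ 2)%:E)%E.
Proof.
move=> e0; rewrite Lnorm2E.
have -> : e%:E = sqrte (e ^+ 2)%:E by rewrite /= sqrtr_sqr ger0_norm.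
by rewrite lee_sqrt// lee_fin sqr_ge0.
Qed.

Definition truncation (M : nat) (f : W -> R) (w : W) : R :=
  Num.max (- M%:R) (Num.min M%:R (f w)).

Lemma measurable_truncation M f :
  measurable_fun setT f -> measurable_fun setT (truncation M f).
Proof.
by move=> mf; apply: measurable_maxr => //; exact: measurable_minr.
Qed.

Lemma truncation_le M f w : - M%:R <= truncation M f w <= M%:R.
Proof.
rewrite /truncation le_max lexx/= ge_max ge_min lexx/= andbT.
by rewrite lerNl (le_trans _ (ler0n _ _))// oppr_le0.
Qed.

Lemma truncation_id M f w : `|f w| <= M%:R -> truncation M f w = f w.
Proof.
rewrite ler_norml => /andP[f1 f2].
by rewrite /truncation (min_idPr f2) (max_idPr f1).
Qed.

(** Supplies the dominating function for the convergence of truncations in L2. *)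
Lemma truncation_sqr_le M f w : (f w - truncation M f w) ^+ 2 <= f w ^+ 2.
Proof.
have [fM|Mf] := leP (`|f w|) M%:R.
  by rewrite truncation_id// subrr expr0n sqr_ge0.
rewrite /truncation.
have M0 : 0 <= M%:R :> R by [].
have [f0|f0] := leP 0 (f w).
  rewrite ger0_norm// in Mf.
  rewrite (min_idPl (ltW Mf)) (max_idPr _); last by lra.
  by nra.
rewrite ltr0_norm// in Mf.
rewrite (min_idPr _); last by lra.
rewrite (max_idPl _); last by lra.
by nra.
Qed.

Lemma truncation_L2 f (e : R) : f \in Lfun P 2%:E -> 0 < e ->
  exists2 M : nat, (0 < M)%N &
    (\int[P]_x ((f x - truncation M f x) ^+ 2)%:E <= e%:E)%E.
Proof.
move=> L2f e0.
have mf : measurable_fun setT f by have := sub_Lfun_mfun L2f; rewrite inE.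
have mg M : measurable_fun setT (fun x => ((f x - truncation M f x) ^+ 2)%:E).
  apply/measurable_EFinP; apply: measurable_funX; apply: measurable_funB => //.
  exact: measurable_truncation.
have [] := @dominated_convergence _ _ _ P setT measurableT
  (fun M x => ((f x - truncation M f x) ^+ 2)%:E) (cst 0%E) (EFin \o (fun x => f x ^+ 2)) mg.
- exact: measurable_cst.
- apply: aeW => x _; apply: cvg_near_cst.
  near=> M; rewrite truncation_id ?subrr ?expr0n//.
  by near: M; exact: nbhs_infty_ger.
- exact: Lfun2_integrable_sqr.
- apply: aeW => x n _; rewrite gee0_abs ?lee_fin ?sqr_ge0//.
  exact: truncation_sqr_le.
move=> _ _; rewrite integral0 => cv.
have [N _ HN] := cvge0_small cv e0.
exists N.+1 => //; exact: (HN N.+1 (leqnSn N)).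
Unshelve. all: by end_near. Qed.

End L2_convergence.

(** A truncation [g] of [f] is close to [f] in L2, and rescaled to [0, 1] it converges in L1 by
    convergence of its level sets. For bounded functions L1 convergence gives L2 convergence, and
    the truncation error is the same along the iterates because they preserve measure. *)
Lemma rigid_of_sets (R : realType) d (W : measurableType d) (P : probability W R)
    (V : W -> W) (q : nat -> nat) :
  measure_preserving P P V -> q n @[n --> \oo] --> \oo ->
  (forall E, measurable E -> converging_sets P (fun n => iter (q n) V) id E) ->
  rigid P V.
Proof.
move=> mpV qoo HV; exists q; split => // f L2f.
have mf : measurable_fun setT f by have := sub_Lfun_mfun L2f; rewrite inE.
apply: ge0_cvge0 => [n|e e0]; first exact: Lnorm_ge0.
(* The final bound is three times the sum of two truncation errors [e ^+ 2 / 12] and of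
   [4 * M%:R ^+ 2] times the L1 distance. The latter distance is made at most
   [e ^+ 2 / (24 * M%:R ^+ 2)], so that the total is [e ^+ 2]. *)
have eta0 : 0 < e ^+ 2 / 12 by rewrite divr_gt0// exprn_gt0.
have [M M0 SM] := truncation_L2 L2f eta0.
have MR0 : 0 < M%:R :> R by rewrite ltr0n.
pose g := truncation M f.
have mg : measurable_fun setT g by exact: measurable_truncation.
pose v x := (g x + M%:R) / (2 * M%:R).
have mv : measurable_fun setT v.
  by apply: measurable_funM => //; apply: measurable_funD.
have v01 x : 0 <= v x <= 1.
  have /andP[g1 g2] := truncation_le M f x; rewrite -/(g x) in g1 g2.
  rewrite /v ler_pdivrMr ?mulr_gt0// mul1r divr_ge0 ?mulr_ge0//=; last by lra.
  lra.
have mpi n : measure_preserving P P (iter (q n) V) by exact: measure_preserving_iter.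
have mvn n : measurable_fun setT (v \o iter (q n) V).
  by apply: measurableT_comp => //; exact: (mpi n).1.
have del0 : 0 < e ^+ 2 / (24 * M%:R ^+ 2).
  by rewrite divr_gt0 ?exprn_gt0// mulr_gt0// exprn_gt0.
have := converging_sets_L1 (P := P) mvn mv (fun n x => v01 (iter (q n) V x)) v01 _ del0.
have cE E : measurable E -> converging_sets P (fun n => v \o iter (q n) V) v E.
  move=> mE; split => //; apply: (HV (v @^-1` E) _).2.
  by rewrite -[X in measurable X]setTI; exact: mv.
move=> /(_ cE); apply: filterS => n Hn.
apply: Lnorm2_le; first exact: ltW.
have mD h : measurable_fun setT h ->
    measurable_fun setT (fun x : W => ((f (h x) - g (h x)) ^+ 2)%:E).
  move=> mh; apply/measurable_EFinP; apply: measurable_funX; apply: measurable_funB.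
    exact: measurableT_comp mf mh.
  exact: measurableT_comp mg mh.
have mDn := mD _ (mpi n).1; have mDid := mD _ (@measurable_id _ W setT).
have mL := measurable_dist (mvn n) mv.
apply: (@le_trans _ _ (\int[P]_x (3%:E * (((f (iter (q n) V x) - g (iter (q n) V x)) ^+ 2)%:E
   + ((f x - g x) ^+ 2)%:E + (4 * M%:R ^+ 2)%:E * `|v (iter (q n) V x) - v x|%:E)))%E).
  apply: ge0_le_integral => //.
  - by move=> x _; rewrite lee_fin sqr_ge0.
  - apply/measurable_EFinP; apply: measurable_funX; apply: measurable_funB => //.
    exact: measurableT_comp mf (mpi n).1.
  - apply: measurable_funeM; apply: emeasurable_funD.
      exact: emeasurable_funD.
    exact: measurable_funeM.
  move=> x _; rewrite -!EFinM lee_fin.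
  set y := iter (q n) V x.
  (* The square is at most the absolute value because [v] takes values in [0, 1]. *)
  have : (g y - g x) ^+ 2 <= 4 * M%:R ^+ 2 * `|v y - v x|.
    have -> : g y - g x = 2 * M%:R * (v y - v x).
      by rewrite /v; field; rewrite pnatr_eq0 -lt0n.
    rewrite exprMn exprMn -(real_normK (num_real (v y - v x))) (_ : 2 ^+ 2 = 4); last by ring.
    rewrite ler_pM2l; last by rewrite mulr_gt0// exprn_gt0.
    rewrite expr2 ler_piMl//.
    have /andP[? ?] := v01 y; have /andP[? ?] := v01 x.
    by rewrite ler_norml; apply/andP; split; lra.
  set K := 4 * _ * _; move: K (f y) (g y) (f x) (g x) => K a a' b b' H.
  (* These squares express that [3 * (a ^+ 2 + b ^+ 2 + c ^+ 2) - (a + b + c) ^+ 2] is the sum of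
     the squared pairwise differences. *)
  have s1 := sqr_ge0 ((a - a') - (a' - b')).
  have s2 := sqr_ge0 ((a' - b') - (b' - b)).
  have s3 := sqr_ge0 ((a - a') - (b' - b)).
  nra.
rewrite ge0_integralZl//; last 2 first.
- by apply: emeasurable_funD; [exact: emeasurable_funD|exact: measurable_funeM].
- by move=> x _; rewrite -!EFinM lee_fin addr_ge0 ?mulr_ge0 ?addr_ge0 ?sqr_ge0.
rewrite ge0_integralD//; last 3 first.
- by move=> x _; rewrite -EFinD lee_fin addr_ge0 ?sqr_ge0.
- exact: emeasurable_funD.
- exact: measurable_funeM.
rewrite ge0_integralD//; last 2 first.
- by move=> x _; rewrite lee_fin sqr_ge0.
- by move=> x _; rewrite lee_fin sqr_ge0.
rewrite ge0_integralZl//.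
have -> : (\int[P]_x ((f (iter (q n) V x) - g (iter (q n) V x)) ^+ 2)%:E =
           \int[P]_x ((f x - g x) ^+ 2)%:E)%E.
  apply: (ge0_integral_mp (mpi n) mDid) => x.
  by rewrite lee_fin sqr_ge0.
apply: (@le_trans _ _ (3%:E * ((e ^+ 2 / 12)%:E + (e ^+ 2 / 12)%:E +
   (4 * M%:R ^+ 2)%:E * (e ^+ 2 / (24 * M%:R ^+ 2))%:E))%E).
  rewrite lee_pmul2l//; apply: leeD; first exact: leeD.
  by rewrite lee_pmul2l ?lte_fin ?mulr_gt0 ?exprn_gt0.
rewrite -!EFinM lee_fin.
rewrite (_ : 4 * M%:R ^+ 2 * (e ^+ 2 / (24 * M%:R ^+ 2)) = e ^+ 2 / 6); first lra.
by field; rewrite pnatr_eq0 -lt0n.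
Qed.

(** * The factor of rigid sets *)

Definition rigid_sets (R : realType) d (W : measurableType d)
    (P : probability W R) (V : W -> W) (q : nat -> nat) : set (set W) :=
  converging_sets P (fun n => iter (q n) V) id.

Section rigid_sets.
Context (R : realType) d (W : measurableType d) (P : probability W R)
  (V : W -> W) (q : nat -> nat).
Hypotheses (mpV : measure_preserving P P V) (qoo : q n @[n --> \oo] --> \oo).
Implicit Types E F : set W.

Let mpi n : measure_preserving P P (iter n V).
Proof. exact: measure_preserving_iter. Qed.

Lemma rigid_sets_measurable : rigid_sets P V q `<=` measurable.
Proof. by move=> E []. Qed.

Lemma rigid_sets_sigma_algebra : sigma_algebra [set: W] (rigid_sets P V q).
Proof.
by apply: converging_sets_sigma_algebra => //; exact: measure_preserving_id.
Qed.

(** Iterates of [V] commute, and [iter n V] preserves the measure of the symmetric differences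
    involved. *)
Lemma rigid_sets_preimage n E : rigid_sets P V q E ->
  rigid_sets P V q (iter n V @^-1` E).
Proof.
move=> [mE cE]; split; first exact: mp_measurable (mpi n) mE.
move=> e /cE; apply: filterS => k; congr (_ <= _)%E.
rewrite -[LHS](mpi n).2; last first.
  by apply: measurable_setY => //; exact: mp_measurable (mpi _) mE.
by congr (P _); apply/funext => w; rewrite /setY /= -!iterD addnC.
Qed.

(* E is the limit of the sets V^-1 (V^-(q n - 1) E), and V^-1 is an isometry of
   the measure algebra. *)
Lemma rigid_sets_onto E : rigid_sets P V q E ->
  exists2 F, rigid_sets P V q F & P (V @^-1` F `+` E) = 0%E.
Proof.
move=> ZE; have [mE cE] := ZE.
have pos n : 0 < 1 / (2 ^ n)%:R :> R by rewrite divr_gt0// ltr0n expn_gt0.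
have pow n : 1 / (2 ^ n.+1)%:R = 1 / (2 ^ n)%:R / 2 :> R.
  by rewrite expnS natrM; field; rewrite pnatr_eq0 expn_eq0.
(* Positivity of [q n], eventually true as [q] tends to infinity, allows one factor [V] to be split
   off. The tolerance brings consecutive [F k] within [1 / 2 ^ (k + 1)], the rate that completeness
   asks for. *)
have ex k : exists n, (0 < q n)%N /\
    (P (iter (q n) V @^-1` E `+` E) <= (1 / (2 ^ k.+3)%:R)%:E)%E.
  have [n _ Hn] : \forall n \near \oo, (0 < q n)%N /\
      (P (iter (q n) V @^-1` E `+` E) <= (1 / (2 ^ k.+3)%:R)%:E)%E.
    have q0 : \forall n \near \oo, (0 < q n)%N.
      exact: (@qoo [set m | (0 < m)%N] (nbhs_infty_gt 0)).
    by apply: filterI => //; exact: cE.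
  by exists n; exact: (Hn n (leqnn n)).
have [n_ Hn_] := choice ex.
pose F k := iter (q (n_ k)).-1 V @^-1` E.
have VF k : V @^-1` F k = iter (q (n_ k)) V @^-1` E.
  rewrite /F -[in RHS](prednK (Hn_ k).1); apply/funext => w.
  by rewrite /preimage /= -iterSr.
have ZF k : rigid_sets P V q (F k) by exact: rigid_sets_preimage.
have mF k : measurable (F k) := rigid_sets_measurable (ZF k).
have mVF k : measurable (V @^-1` F k) by exact: mp_measurable mpV (mF k).
have VFE k : (P (V @^-1` F k `+` E) <= (1 / (2 ^ k.+3)%:R)%:E)%E.
  by rewrite VF; exact: (Hn_ k).2.
have [|G ZG FG] := measure_algebra_complete rigid_sets_sigma_algebra
    rigid_sets_measurable ZF (P := P).
  move=> k; rewrite -mpV.2 ?preimage_setY; last exact: measurable_setY.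
  apply: (setY_triangle_le (B := E) (a := 1 / (2 ^ k.+3)%:R) (b := 1 / (2 ^ k.+4)%:R)) => //.
  - by rewrite !pow; have := pos k; lra.
  - by rewrite setYC.
exists G => //; apply: ge0_small_eq0; first exact: measure_ge0.
have mG := rigid_sets_measurable ZG.
move=> e e0; have [k ke] := pow2_small e0.
apply: (setY_triangle_le (B := V @^-1` F k.+1)
  (a := 1 / (2 ^ k.+1)%:R) (b := 1 / (2 ^ k.+4)%:R)) => //.
- exact: mp_measurable mpV mG.
- by apply: le_trans ke; rewrite !pow; have := pos k; lra.
- rewrite setYC -preimage_setY mpV.2; first exact: FG.
  exact: measurable_setY.
Qed.

Theorem rigid_sets_factor : countably_generated W ->
  exists (h : W -> R) (Q : probability R R) (U : R -> R),
  [/\ measure_preserving P Q h, forall w, 0 <= h w <= 1,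
      forall E : set R, measurable E -> rigid_sets P V q (h @^-1` E),
      forall E, rigid_sets P V q E ->
        exists2 F : set R, measurable F & P (E `+` h @^-1` F) = 0%E &
      [/\ automorphism Q U, \forall w \ae P, h (V w) = U (h w) & rigid Q U]].
Proof.
move=> cW.
have sZ := rigid_sets_sigma_algebra.
have [D [ZD dD]] := sigma_algebra_coded P cW sZ rigid_sets_measurable.
set h := ternary_code R D in dD.
have mD n : measurable (D n) := rigid_sets_measurable (ZD n).
have mh : measurable_fun setT h by exact: measurable_ternary_code.
have [Q mpQ] := image_probability P mh.
have mhE (E : set R) : measurable E -> measurable (h @^-1` E) by exact: mp_measurable mpQ.
have Zh (E : set R) : measurable E -> rigid_sets P V q (h @^-1` E).
  exact: preimage_ternary_code.
have /choice[F HF] : forall n, exists F : set R, measurable F /\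
    P (V @^-1` D n `+` h @^-1` F) = 0%E.
  by move=> n; have [F mF PF] := dD _ (rigid_sets_preimage 1 (ZD n)); exists F.
(* The digits of the inverse: [D' n] is a rigid set that [V] pulls back to [D n], so membership of
   [w] in [D n] can be read from [h (V w)]. *)
have /choice[D' HD'] : forall n, exists E, rigid_sets P V q E /\
    P (V @^-1` E `+` D n) = 0%E.
  by move=> n; have [E ZE PE] := rigid_sets_onto (ZD n); exists E.
have /choice[F' HF'] : forall n, exists F : set R, measurable F /\
    P (D' n `+` h @^-1` F) = 0%E.
  by move=> n; have [F' mF' PF'] := dD _ (HD' n).1; exists F'.
have mD' n : measurable (D' n) := rigid_sets_measurable (HD' n).1.
(* The code h (V w) has digits D n (V w), that is, F n (h w). *)
pose U := ternary_code R F; pose U' := ternary_code R F'.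
have mU : measurable_fun setT U.
  by apply: measurable_ternary_code => n; exact: (HF n).1.
have mU' : measurable_fun setT U'.
  by apply: measurable_ternary_code => n; exact: (HF' n).1.
have hV : \forall w \ae P, h (V w) = U (h w).
  have : \forall w \ae P, forall n, D n (V w) <-> F n (h w).
    apply: ae_foralln => n.
    apply: (setY0_ae (A := V @^-1` D n) (B := h @^-1` F n)) (HF n).2.
      exact: mp_measurable mpV (mD n).
    exact: mhE (HF n).1.
  by apply: filterS => w Hw; exact: eq_ternary_code.
have hV' : \forall w \ae P, U' (h (V w)) = h w.
  have : \forall w \ae P, forall n, F' n (h (V w)) <-> D n w.
    apply: ae_foralln => n.
    have H1 : \forall w \ae P, D' n (V w) <-> D n w.
      apply: (setY0_ae (A := V @^-1` D' n)) (HD' n).2 => //.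
      exact: mp_measurable mpV (mD' n).
    have H2 : \forall w \ae P, D' n (V w) <-> F' n (h (V w)).
      apply: (mp_ae mpV (p := fun w => D' n w <-> F' n (h w))).
      apply: (setY0_ae (A := D' n) (B := h @^-1` F' n)) (HF' n).2 => //.
      exact: mhE (HF' n).1.
    apply: filterS2 H1 H2 => w H1 H2.
    by split => [/H2/H1|/H1/H2].
  by apply: filterS => w Hw; exact: eq_ternary_code.
have mpU : measure_preserving Q Q U.
  split => // E mE; have mUE : measurable (U @^-1` E).
    by rewrite -[X in measurable X]setTI; exact: mU.
  rewrite -!mpQ.2//.
  rewrite -(mpV.2 (h @^-1` E)); last exact: mhE.
  apply: setY0_measure; first exact: mhE.
    by apply: mp_measurable mpV _; exact: mhE.
  apply: ae_setY0; first exact: mhE.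
    by apply: mp_measurable mpV _; exact: mhE.
  by apply: filterS hV => w; rewrite /preimage/= => ->.
have mpU' : measure_preserving Q Q U'.
  split => // E mE; have mUE : measurable (U' @^-1` E).
    by rewrite -[X in measurable X]setTI; exact: mU'.
  rewrite -!mpQ.2//.
  rewrite -(mpV.2 (h @^-1` _)); last exact: mhE.
  have m1 : measurable (V @^-1` (h @^-1` (U' @^-1` E))).
    by apply: mp_measurable mpV _; exact: mhE.
  apply: setY0_measure => //; first exact: mhE.
  apply: ae_setY0 => //; first exact: mhE.
  by apply: filterS hV' => w; rewrite /preimage/= => ->.
have mpVi n := measure_preserving_iter n mpV.
have mpUi n := measure_preserving_iter n mpU.
have hVi n : \forall w \ae P, h (iter n V w) = iter n U (h w).
  elim: n => [|n IH]; first exact: aeW.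
  have := mp_ae (mpVi n) hV.
  by apply: filterS2 IH => w IH; rewrite /= => ->; rewrite IH.
have meq (f g : R -> R) : measurable_fun setT f -> measurable_fun setT g ->
    measurable [set t | f t = g t].
  move=> mf mg.
  rewrite (_ : [set t | _] = setT `&` [set t | (f t)%:E = (g t)%:E]).
    by apply: measurable_eqe => //; exact/measurable_EFinP.
  by rewrite setTI; apply/seteqP; split => t /= => [->|[]].
exists h, Q, U; split => //.
- by move=> w; exact: ternary_code01.
split => //.
- split => //; exists U'; split => //.
  + apply: (mp_aeV mpQ (A := [set t | U' (U t) = t])).
      by apply: meq => //; exact: measurableT_comp.
    by apply: filterS2 hV hV' => w /= <-.
  + apply: (mp_aeV mpQ (A := [set t | U (U' t) = t])).
      by apply: meq => //; exact: measurableT_comp.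
    (* The identity is checked at points [V w], where [U'] sends [h (V w)] to [h w] and [U] sends it
       back. *)
    apply: (mp_aeV mpV (A := h @^-1` [set t | U (U' t) = t])).
      by apply: mhE; apply: meq => //; exact: measurableT_comp.
    by apply: filterS2 hV hV' => w /= H1 H2; rewrite H2 -H1.
- apply: (rigid_of_sets (q := q)) => // E mE; split => // e e0.
  have := (Zh _ mE).2 _ e0; apply: filterS => n.
  congr (_ <= _)%E.
  have mUE : measurable (iter (q n) U @^-1` E) by exact: mp_measurable (mpUi _) mE.
  rewrite -(mpQ.2 (_ `+` _)); last exact: measurable_setY.
  have mhVE : measurable (iter (q n) V @^-1` (h @^-1` E)).
    by apply: mp_measurable (mpVi _) _; exact: mhE.
  apply: setY0_measure.
  + by apply: measurable_setY => //; exact: mhE.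
  + by apply: mhE; exact: measurable_setY.
  apply: ae_setY0.
  + by apply: measurable_setY => //; exact: mhE.
  + by apply: mhE; exact: measurable_setY.
  by apply: filterS (hVi (q n)) => w; rewrite /setY /preimage /= => ->.
Qed.

End rigid_sets.

(** * Standard Borel spaces *)

Lemma second_countable_R (R : realType) : @second_countable R.
Proof.
pose I (pq : rat * rat) := `]ratr pq.1 : R, ratr pq.2[%classic.
exists (range I); first exact: card_le_trans (card_image_le _ _) (countableP _).
split; first by move=> _ [pq _ <-]; exact: interval_open.
move=> x U /nbhs_ballP[e /= e0 xU].
have [p /andP[p1 p2]] : exists p : rat, x - e < ratr p < x.
  have [p] := @rat_in_itvoo R (x - e) x ltac:(lra).
  by rewrite in_itv/=; exists p.
have [r /andP[r1 r2]] : exists p : rat, x < ratr p < x + e.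
  have [r] := @rat_in_itvoo R x (x + e) ltac:(lra).
  by rewrite in_itv/=; exists r.
exists (I (p, r)).
  by split; [exists (p, r)|rewrite /I /= in_itv/= p2 r1].
move=> y; rewrite /I /= in_itv/= => /andP[y1 y2]; apply: xU.
by rewrite /ball/= ltr_norml; apply/andP; split; lra.
Qed.

Lemma standard_borel_R (R : realType) : standard_borel R R.
Proof.
exists R, id; split.
- exact: norm_hausdorff.
- exact: second_countable_R.
- exact: (@Bijective _ _ id id).
rewrite /preimage_set_system; apply/seteqP; split => [E mE|_ [E sE <-]].
  exists E; last by rewrite setTI.
  apply: (preimage_sigma_algebra_R (K := <<s open >>) (f := id)) mE => [|a].
    exact: smallest_sigma_algebra.
  apply: sub_sigma_algebra; exact: open_gt.
rewrite setTI.
apply: (sigma_generated_ind (K := measurable)) sE; first exact: sigma_algebra_measurable.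
by move=> U oU; exact: open_measurable.
Qed.

(* Without this instance products are not recognized as pointed uniform spaces. *)
HB.instance Definition _ (M1 M2 : puniformType) := Pointed.on (M1 * M2)%type.

Lemma prod_cauchy_cvg (R : realType) (M1 M2 : completePseudoMetricType R)
    (F : set_system (M1 * M2)%type) : ProperFilter F -> cauchy F -> cvg F.
Proof.
move=> FF /cauchyP Fc.
have c1 : cauchy (fst @ F).
  apply/cauchyP => e e0; have [x Fx] := Fc _ e0; exists x.1.
  by apply: (@filterS _ F _ (ball x e) (fst @^-1` ball x.1 e)) => // y [].
have c2 : cauchy (snd @ F).
  apply/cauchyP => e e0; have [x Fx] := Fc _ e0; exists x.2.
  by apply: (@filterS _ F _ (ball x e) (snd @^-1` ball x.2 e)) => // y [].
have [l1 l1P] := (cvg_ex _).1 (@cauchy_cvg M1 _ _ c1).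
have [l2 l2P] := (cvg_ex _).1 (@cauchy_cvg M2 _ _ c2).
apply/(cvg_ex _); exists (l1, l2) => U [[A B] [/= lA lB] AB].
have FA : F (fst @^-1` A) by exact: l1P.
have FB : F (snd @^-1` B) by exact: l2P.
by apply: filterS (filterI FA FB) => -[x y] [/= Ax By]; exact: AB.
Qed.

HB.instance Definition _ (R : realType) (M1 M2 : completePseudoMetricType R) :=
  Uniform_isComplete.Build (M1 * M2)%type (@prod_cauchy_cvg R M1 M2).

Section product_standard_borel.
Context (R : realType).

Lemma openX (M1 M2 : topologicalType) (A : set M1) (B : set M2) :
  open A -> open B -> open (A `*` B).
Proof.
move=> oA oB; rewrite (_ : A `*` B = fst @^-1` A `&` snd @^-1` B)//.
apply: openI; apply: open_comp => // x _; [exact: cvg_fst|exact: cvg_snd].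
Qed.

Lemma hausdorff_prod (M1 M2 : topologicalType) : hausdorff_space M1 ->
  hausdorff_space M2 -> hausdorff_space (M1 * M2)%type.
Proof.
move=> h1 h2 [p1 p2] [q1 q2] cl; congr (_, _).
- apply: h1 => A B pA qB.
  have [||[x y] [[/= Ax _] [/= Bx _]]] := cl (A `*` setT) (B `*` setT).
  + by exists (A, setT) => //; split => //; exact: filterT.
  + by exists (B, setT) => //; split => //; exact: filterT.
  by exists x.
- apply: h2 => A B pA qB.
  have [||[x y] [[/= _ Ay] [/= _ By]]] := cl (setT `*` A) (setT `*` B).
  + by exists (setT, A) => //; split => //; exact: filterT.
  + by exists (setT, B) => //; split => //; exact: filterT.
  by exists y.
Qed.

Lemma second_countable_prod (M1 M2 : topologicalType) : @second_countable M1 ->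
  @second_countable M2 -> @second_countable (M1 * M2)%type.
Proof.
move=> /second_countable_seq[e1 [eo1 b1]] /second_countable_seq[e2 [eo2 b2]].
exists (range (fun nm : nat * nat => e1 nm.1 `*` e2 nm.2)).
  exact: card_le_trans (card_image_le _ _) (countableP _).
split; first by move=> _ [nm _ <-]; exact: openX.
move=> [x y] U [[A B] [/= xA yB] ABU].
rewrite !nbhsE in xA yB; case: xA yB =>  [A' [oA' A'x] A'A] [B' [oB' B'y] B'B].
have [n [nx nA]] := b1 _ _ oA' A'x; have [m [my mB]] := b2 _ _ oB' B'y.
exists (e1 n `*` e2 m); first by split => //; exists (n, m).
by move=> [u v] [/= un vm]; apply: ABU; split; [exact/A'A/nA|exact/B'B/mB].
Qed.

(** The delicate inclusion is that open sets of the product metric space pull back into the product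
    sigma-algebra: the countable bases write such a set as a countable union of open rectangles. *)
Lemma standard_borel_prod d1 d2 (W1 : measurableType d1) (W2 : measurableType d2) :
  standard_borel R W1 -> standard_borel R W2 -> standard_borel R (W1 * W2)%type.
Proof.
move=> [M1 [f1 [h1 c1 [g1 fK1 gK1] m1]]] [M2 [f2 [h2 c2 [g2 fK2 gK2] m2]]].
pose M : completePseudoMetricType R := (M1 * M2)%type.
pose f (w : W1 * W2) : M := (f1 w.1, f2 w.2).
exists M, f; split.
- exact: hausdorff_prod.
- exact: second_countable_prod.
- by exists (fun z : M => (g1 z.1, g2 z.2)) => -[x y];
    rewrite /f /= ?fK1 ?fK2 ?gK1 ?gK2.
have sB : sigma_algebra [set: W1 * W2] (preimage_set_system setT f <<s @open M >>).
  by apply: sigma_algebra_preimage; exact: smallest_sigma_algebra.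
have sO : sigma_algebra [set: M] <<s @open M >> by exact: smallest_sigma_algebra.
apply/seteqP; split => [E|_ [V sV <-]].
  rewrite measurable_prod_measurableType.
  apply: sigma_generated_ind => // _ [A mA [B mB <-]].
  move: mA mB; rewrite m1 m2 => -[V1 sV1 <-] [V2 sV2 <-].
  have H1 : <<s @open M >> (fst @^-1` V1).
    apply: (sigma_generated_ind (sigma_algebra_preim fst sO)) sV1.
    move=> O oO /=; apply: sub_sigma_algebra.
    by apply: open_comp => // x _; exact: cvg_fst.
  have H2 : <<s @open M >> (snd @^-1` V2).
    apply: (sigma_generated_ind (sigma_algebra_preim snd sO)) sV2.
    move=> O oO /=; apply: sub_sigma_algebra.
    by apply: open_comp => // x _; exact: cvg_snd.
  exists ((fst @^-1` V1) `&` (snd @^-1` V2)); last first.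
    by rewrite !setTI; apply/seteqP; split => -[x y].
  exact: (sigma_algebra_setI sO).
rewrite setTI.
have sM := @sigma_algebra_measurable _ (W1 * W2)%type.
apply: (sigma_generated_ind (sigma_algebra_preim f sM)) sV => U oU /=.
have [e1 [eo1 b1]] := second_countable_seq c1.
have [e2 [eo2 b2]] := second_countable_seq c2.
have -> : U = \bigcup_(nm in [set nm : nat * nat | e1 nm.1 `*` e2 nm.2 `<=` U])
    (e1 nm.1 `*` e2 nm.2).
  apply/seteqP; split => [[x y] Uxy|z [nm nmU nmz]]; last exact: nmU.
  have [[A B] [/= xA yB] ABU] := open_nbhs_nbhs (conj oU Uxy).
  rewrite !nbhsE in xA yB; case: xA yB =>  [A' [oA' A'x] A'A] [B' [oB' B'y] B'B].
  have [n [nx nA]] := b1 _ _ oA' A'x; have [m [my mB]] := b2 _ _ oB' B'y.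
  by exists (n, m) => //= -[u v] [/= un vm]; apply: ABU; split; [exact/A'A/nA|exact/B'B/mB].
rewrite preimage_bigcup bigcup_mkcond.
apply: countable_bigcupT_measurable => [|nm]; first exact: countableP.
case: ifPn => // _.
rewrite (_ : _ @^-1` _ = (f1 @^-1` e1 nm.1) `*` (f2 @^-1` e2 nm.2))//.
apply: measurableX; [rewrite m1; exists (e1 nm.1)|rewrite m2; exists (e2 nm.2)];
  by rewrite ?setTI//; exact: sub_sigma_algebra.
Qed.

End product_standard_borel.

(** * Mild mixing *)

Section not_mildly_mixing.
Context (R : realType) d (W : measurableType d) (P : probability W R)
  (V : W -> W).

(** The rigid factor is the sigma-algebra pulled back by [f], and [W'] itself, with the map [f],
    serves as its quotient space. *)
Lemma not_mildly_mixing_factor d' (W' : measurableType d') (Q : probability W' R)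
    (f : W -> W') (U : W' -> W') (E : set W') :
  standard_borel R W' -> measure_preserving P Q f -> automorphism Q U ->
  measure_preserving P P V ->
  (\forall w \ae P, f (V w) = U (f w)) -> rigid Q U ->
  measurable E -> (0 < Q E < 1)%E -> ~ mildly_mixing P V.
Proof.
move=> std mpf autU mpV fV rU mE E01; apply.
have [mpU [U' [mpU' U'U UU']]] := autU.
pose A := preimage_set_system [set: W] f measurable.
have sA : sigma_algebra [set: W] A.
  exact: sigma_algebra_preimage (sigma_algebra_measurable _).
have mfE F : measurable F -> measurable (f @^-1` F) by exact: mp_measurable mpf.
have VfE F : measurable F -> P (V @^-1` (f @^-1` F) `+` f @^-1` (U @^-1` F)) = 0%E.
  move=> mF; apply: ae_setY0.
  - exact: mp_measurable mpV (mfE _ mF).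
  - exact/mfE/(mp_measurable mpU mF).
  by apply: filterS fV => w; rewrite /preimage /= => ->.
exists A; split.
- split => //.
    by move=> _ [F mF <-]; rewrite setTI; exact: mfE.
  split.
    move=> _ [_ [F mF <-] <-]; exists (f @^-1` (U @^-1` F)).
      by exists (U @^-1` F); [exact: mp_measurable mpU mF|rewrite setTI].
    by rewrite !setTI; exact: VfE.
  move=> _ [F mF <-]; rewrite setTI.
  have mU'F := mp_measurable mpU' mF.
  exists (V @^-1` (f @^-1` (U' @^-1` F))).
    exists (f @^-1` (U' @^-1` F)); last by rewrite setTI.
    by exists (U' @^-1` F); rewrite ?setTI.
  apply: (setY0_trans (B := f @^-1` (U @^-1` (U' @^-1` F)))).
  - exact: mfE.
  - exact/mfE/(mp_measurable mpU mU'F).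
  - exact: mp_measurable mpV (mfE _ mU'F).
  - rewrite -preimage_setY mpf.2; last first.
      by apply: measurable_setY => //; exact: mp_measurable mpU mU'F.
    apply: ae_setY0 => //; first exact: mp_measurable mpU mU'F.
    by apply: filterS U'U => w; rewrite /preimage /= => ->.
  - by rewrite setYC; exact: VfE.
- exists (f @^-1` E); last by rewrite mpf.2.
  by exists E; rewrite ?setTI.
- have eA : ae_equal P (preimage_set_system [set: W] f measurable) A.
    by split=> F AF; exists F => //; rewrite setYK measure0.
  exists (QuotientSpace std mpf eA), U; split => //.
Qed.

(** Rigidity tested on the indicator of a set [F] of the quotient: the squared L2 norm dominates the
    measure of the symmetric difference of [F] and its preimage, and this difference pulls back to
    [W]. *)
Lemma not_mildly_mixing_rigid_set : measure_preserving P P V ->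
  ~ mildly_mixing P V -> exists q : nat -> nat, q n @[n --> \oo] --> \oo /\
    exists2 E, rigid_sets P V q E & (0 < P E < 1)%E.
Proof.
move=> mpV /contrapT[A [[sA Am _] [E AE E01] [Q [VA [[autVA rVA] [q [qoo rq]]]]]]].
exists q; split => //.
have mE := Am _ AE.
have [_ /(_ _ AE)[_ [F mF <-] EF]] := quo_mapE Q.
move: EF; rewrite setTI => EF.
set f := quo_map Q in EF rVA.
have mpf : measure_preserving P (quo_prob Q) f := quo_map_preserving Q.
have mfF := mp_measurable mpf mF.
(* The set [E] itself is only equal to this preimage modulo a null set. *)
exists (f @^-1` F); last by rewrite -(setY0_measure mE mfF EF).
have [mpVA _] := autVA.
have mpVi n := measure_preserving_iter n mpV.
have mpVAi n := measure_preserving_iter n mpVA.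
have fVi n : \forall w \ae P, f (iter n V w) = iter n VA (f w).
  elim: n => [|n IH]; first exact: aeW.
  have := mp_ae (mpVi n) rVA.
  by apply: filterS2 IH => w IH; rewrite /= => ->; rewrite IH.
split => // e e0.
have L2F : (\1_F : Q -> R) \in Lfun (quo_prob Q) 2%:E.
  have mF1 : measurable_fun setT (\1_F : Q -> R) by exact: measurable_indic.
  rewrite inE; apply/andP; split; rewrite inE//= /finite_norm.
  apply: (@le_lt_trans _ _ 1%E); last exact: ltry.
  apply: Lnorm2_le => //; apply: (@le_trans _ _ (\int[quo_prob Q]_x 1%E)%E).
    apply: ge0_le_integral => //.
    - by apply/measurable_EFinP; exact: measurable_funX.
    - by move=> x _; rewrite lee_fin indicE; case: (x \in F); rewrite ?expr1n ?expr0n.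
  rewrite (integral_cst _ measurableT) mul1e expr1n.
  by rewrite -(probability_setT (quo_prob Q)).
(* The L2 norm is to be squared, hence the tolerance [Num.sqrt e]. *)
have se0 : 0 < Num.sqrt e by rewrite sqrtr_gt0.
have := cvge0_small (rq _ L2F) se0; apply: filterS => n /(le_Lnorm2 (ltW se0)).
rewrite (sqr_sqrtr (ltW e0)) => H; apply: le_trans H.
have mVF := mp_measurable (mpVAi (q n)) mF.
have mS : measurable (iter (q n) VA @^-1` F `+` F) by exact: measurable_setY.
rewrite (_ : P _ = quo_prob Q (iter (q n) VA @^-1` F `+` F)); last first.
  rewrite -(mpf.2 _ mS); apply: setY0_measure.
  - by apply: measurable_setY => //; exact: mp_measurable (mpVi _) mfF.
  - exact: mp_measurable mpf mS.
  apply: ae_setY0.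
  - by apply: measurable_setY => //; exact: mp_measurable (mpVi _) mfF.
  - exact: mp_measurable mpf mS.
  by apply: filterS (fVi (q n)) => w; rewrite /setY /preimage /= => ->.
have -> : quo_prob Q (iter (q n) VA @^-1` F `+` F) =
    (\int[quo_prob Q]_x (\1_(iter (q n) VA @^-1` F `+` F) x)%:E)%E.
  by rewrite integral_indic ?setIT.
apply: ge0_le_integral => //.
- by apply/measurable_EFinP; exact: measurable_indic.
- apply/measurable_EFinP; apply: measurable_funX; apply: measurable_funB.
    apply: measurableT_comp; last exact: (mpVAi _).1.
    exact: measurable_indic.
  exact: measurable_indic.
move=> x _; rewrite lee_fin !indicE.
case: (pselect (F x)) => Fx; case: (pselect (F (iter (q n) VA x))) => FVx;
  rewrite ?(mem_set Fx) ?(memNset Fx) ?(mem_set FVx) ?(memNset FVx);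
  case: (x \in _ `+` _) / boolP; rewrite ?inE /setY /preimage /=; tauto || (move=> *; lra).
Qed.

End not_mildly_mixing.

(** A rigid set of intermediate measure would make the factor generated by all sets rigid along [q]
    non-trivial, and the automorphism induced on that factor is rigid. *)
Lemma mildly_mixing_rigid_set (R : realType) d (W : measurableType d)
    (P : probability W R) (V : W -> W) (q : nat -> nat) (E : set W) :
  countably_generated W -> measure_preserving P P V -> mildly_mixing P V ->
  q n @[n --> \oo] --> \oo -> rigid_sets P V q E -> P E = 0%E \/ P E = 1%E.
Proof.
move=> cW mpV mmV qoo ZE; apply: contrapT => /not_orP[E0 E1].
have mE := rigid_sets_measurable ZE.
have [h [Q [U [mph _ _ dh [autU hV rU]]]]] := rigid_sets_factor mpV qoo cW.
have [F mF EF] := dh _ ZE.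
have PF : P E = Q F.
  by rewrite -(mph.2 _ mF); apply: setY0_measure => //; exact: mp_measurable mph mF.
apply: (not_mildly_mixing_factor (@standard_borel_R R) mph autU mpV hV rU mF) mmV.
rewrite -PF lt_neqAle measure_ge0 andbT lt_neqAle probability_le1// andbT.
by apply/andP; split; apply/eqP => // H; apply: E0.
Qed.

(** * From L1 convergence to convergence of level sets *)

Section convergence_in_law.
Context (R : realType) d (W : measurableType d) (P : probability W R)
  (Q : probability R R) (a : nat -> W -> R) (b : W -> R).
Hypotheses (mpa : forall n, measure_preserving P Q (a n))
  (mpb : measure_preserving P Q b).

(* As [a n] and [b] have the same law, [{b <= c < a n}] and [{a n <= c < b}] have
   the same measure; the latter lies in [{c < b < c + r}] up to a small set, even
   when the law has an atom at [c]. *)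
Lemma converging_sets_law :
  (forall e : R, 0 < e -> \forall n \near \oo, (L1dist P (a n) b <= e%:E)%E) ->
  forall E, measurable E -> converging_sets P a b E.
Proof.
move=> cab E mE.
have sC := converging_sets_sigma_algebra mpa mpb.
apply: (preimage_sigma_algebra_R (f := id) sC) mE => c.
have mray (t : R) : measurable [set s : R | t < s].
  by apply: open_measurable; exact: open_gt.
split => //= e e0.
pose I k := [set s : R | c < s < c + k.+1%:R^-1].
have mI k : measurable (I k).
  rewrite (_ : I k = `]c, c + k.+1%:R^-1[%classic); first exact: measurable_itv.
  by apply/seteqP; split => s /=; rewrite in_itv.
have cI : Q (I k) @[k --> \oo] --> 0%E.
  have I0 : \bigcap_k I k = set0.
    apply/seteqP; split => // s Is.
    have cs : 0 < s - c.
      by have := Is 0%N Logic.I; rewrite /I /= subr_gt0 => /andP[].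
    have [k _ /(_ k (leqnn k)) /= Hk] := near_infty_natSinv_lt (PosNum cs).
    have := Is k Logic.I; rewrite /I /= => /andP[_].
    by move: Hk; set z := _^-1; lra.
  rewrite -(measure0 Q) -I0; apply: nonincreasing_cvg_mu => //.
  - by rewrite (le_lt_trans (probability_le1 _ _)) ?ltry.
  - by rewrite I0.
  - move=> k m km; apply/subsetPset => s; rewrite /I /= => /andP[-> /= H].
    apply: lt_le_trans H _; rewrite lerD2l lef_pV2 ?posrE//.
    by rewrite ler_nat ltnS.
have e4 : 0 < e / 4 by rewrite divr_gt0.
have [k _ /(_ k (leqnn k)) /= Ik] := cvge0_small cI e4.
have r0 : 0 < k.+1%:R^-1 :> R by rewrite invr_gt0.
have := cab _ (mulr_gt0 r0 e4); apply: filterS => n Hn.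
set A := a n @^-1` _; set B := b @^-1` _.
have mA : measurable A by exact: mp_measurable (mpa n) (mray c).
have mB : measurable B by exact: mp_measurable mpb (mray c).
have PAB : P A = P B by rewrite (mpa n).2// mpb.2.
have mAB := measurableI _ _ mA mB.
have fAB : P (A `&` B) \is a fin_num by exact: fin_num_measure.
have PD : P (A `\` B) = P (B `\` A).
  rewrite !measureD//; [|by rewrite (le_lt_trans (probability_le1 _ _)) ?ltry..].
  by congr (_ - _)%E; [exact: PAB|rewrite setIC].
have mL : measurable [set w | k.+1%:R^-1 <= `|a n w - b w|].
  rewrite -[X in measurable X]setTI; apply: measurable_fun_le => //.
  apply: measurableT_comp => //; apply: measurable_funB; first exact: (mpa n).1.
  exact: mpb.1.
have PBA : (P (B `\` A) <= (e / 2)%:E)%E.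
  apply: (@le_trans _ _ (P (b @^-1` I k) + P [set w | (k.+1%:R^-1 <= `|a n w - b w|)%R])%E).
    apply: le_trans (measureU2 _ _ _) => //; last exact: mp_measurable mpb (mI k).
    apply: le_measure; rewrite ?inE.
    - exact: measurableD.
    - by apply: measurableU => //; exact: mp_measurable mpb (mI k).
    move=> w [] /=; rewrite /A /B /preimage /= => cb /negP; rewrite -leNgt => ac.
    have [bc|bc] := ltP (b w) (c + k.+1%:R^-1); first by left; rewrite /I /= cb bc.
    right => /=; rewrite distrC; apply: le_trans (ler_norm _).
    by move: bc; set z := _^-1; lra.
  rewrite [leRHS](_ : _ = (e / 4)%:E + (e / 4)%:E)%E; last by rewrite -EFinD; congr EFin; lra.
  apply: leeD; first by rewrite mpb.2.
  by apply: markov_L1dist Hn => //; [exact: (mpa n).1|exact: mpb.1].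
have PAB' : (P (A `\` B) <= (e / 2)%:E)%E by rewrite PD.
apply: le_trans (measureU2 _ _ _) _; try exact: measurableD.
rewrite [leRHS](_ : _ = (e / 2)%:E + (e / 2)%:E)%E; last by rewrite -EFinD; congr EFin; lra.
by apply: leeD; [exact: PAB'|exact: PBA].
Qed.

End convergence_in_law.

(** The functions [r \o iter (q n) V] have the law of [r], so their L1 convergence makes every set
    [{t < r}] rigid, hence of measure 0 or 1. *)
Lemma mildly_mixing_rigid_fun (R : realType) d (W : measurableType d)
    (P : probability W R) (V : W -> W) (q : nat -> nat) (r : W -> R) :
  countably_generated W -> measure_preserving P P V -> mildly_mixing P V ->
  q n @[n --> \oo] --> \oo -> measurable_fun setT r -> (forall w, 0 <= r w <= 1) ->
  (forall e : R, 0 < e ->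
     \forall n \near \oo, (L1dist P (r \o iter (q n) V) r <= e%:E)%E) ->
  exists c, \forall w \ae P, r w = c.
Proof.
move=> cW mpV mmV qoo mr r01 cr.
have [Q mpr] := image_probability P mr.
have mray (t : R) : measurable [set s : R | t < s].
  by apply: open_measurable; exact: open_gt.
have mrt t : measurable [set w | t < r w] by exact: mp_measurable mpr (mray t).
have H01 t : P [set w | t < r w] = 0%E \/ P [set w | t < r w] = 1%E.
  apply: (mildly_mixing_rigid_set cW mpV mmV qoo); split => // e e0.
  have mpi n : measure_preserving P Q (r \o iter (q n) V).
    exact: measure_preserving_comp (measure_preserving_iter _ mpV) mpr.
  exact: (converging_sets_law mpi mpr cr (mray t)).2.
(* The constant is [sup L]: below it some [{t < r}] has full measure, and above it [{t < r}] does
   not have full measure and is therefore null. *)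
pose L := [set t : R | P [set w | t < r w] = 1%E].
have L1 : L (-1).
  rewrite /L /= (_ : [set w | _] = setT) ?probability_setT//.
  by apply/seteqP; split => w //= _; have /andP[] := r01 w; lra.
have uL : ubound L 1.
  move=> t; rewrite /L /= => Pt; rewrite leNgt; apply/negP => t1.
  move: Pt; rewrite (_ : [set w | _] = set0).
    by rewrite measure0 => /eqP; rewrite eq_sym onee_eq0.
  by apply/seteqP; split => w //=; have /andP[] := r01 w; lra.
have sL : has_sup L by split; [exists (-1)|exists 1].
exists (sup L).
have lo : \forall w \ae P, forall n : nat, sup L - n.+1%:R^-1 < r w.
  apply: ae_foralln => n.
  have n0 : 0 < n.+1%:R^-1 :> R by rewrite invr_gt0.
  have [t Lt tn] := sup_adherent n0 sL.
  have := full_ae (mrt t) Lt; apply: filterS => w /=; exact: lt_trans.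
have hi : \forall w \ae P, forall n : nat, r w <= sup L + n.+1%:R^-1.
  apply: ae_foralln => n.
  have n0 : 0 < n.+1%:R^-1 :> R by rewrite invr_gt0.
  have [P0|P1] := H01 (sup L + n.+1%:R^-1).
    exists [set w | sup L + n.+1%:R^-1 < r w]; split => // w /= /negP.
    by rewrite -ltNge.
  by have := sup_upper_bound sL P1; move: n0; set z := _^-1; lra.
apply: filterS2 lo hi => w lo hi; apply/eqP; rewrite eq_le; apply/andP; split.
  apply/ler_addgt0Pr => e e0.
  have [n _ /(_ n (leqnn n)) /= Hn] := near_infty_natSinv_lt (PosNum e0).
  by have := hi n; move: Hn; set z := _^-1; lra.
apply/ler_addgt0Pr => e e0.
have [n _ /(_ n (leqnn n)) /= Hn] := near_infty_natSinv_lt (PosNum e0).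
by have := lo n; move: Hn; set z := _^-1; lra.
Qed.

Lemma sum_ltn_ord (N t : nat) : (\sum_(k < N) (k < t) = minn N t)%N.
Proof.
elim: N => [|N IH]; first by rewrite big_ord0 min0n.
rewrite big_ord_recr/= IH.
have [Nt|tN] := ltnP N t; first by rewrite (minn_idPl Nt) addn1.
by rewrite (minn_idPr (leqW tN)) addn0.
Qed.

(** * Separability in L1 *)

Section L1_separability.
Context (R : realType) d (W : measurableType d) (P : probability W R).

Lemma eq_L1dist_ae (u u' v v' : W -> R) : measurable_fun setT u ->
  measurable_fun setT u' -> measurable_fun setT v -> measurable_fun setT v' ->
  (\forall w \ae P, u w = u' w) -> (\forall w \ae P, v w = v' w) ->
  L1dist P u v = L1dist P u' v'.
Proof.
move=> mu mu' mv mv' uu vv; apply: ae_eq_integral => //.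
- exact: measurable_dist.
- exact: measurable_dist.
by apply: filterS2 uu vv => w -> -> _.
Qed.

Lemma L1dist_le1 (u v : W -> R) : measurable_fun setT u -> measurable_fun setT v ->
  (forall w, 0 <= u w <= 1) -> (forall w, 0 <= v w <= 1) -> (L1dist P u v <= 1)%E.
Proof.
move=> mu mv u01 v01.
rewrite -(probability_setT P) -[leRHS]mul1e -(integral_cst P measurableT).
apply: ge0_le_integral => //; first exact: measurable_dist.
move=> w _; rewrite lee_fin ler_norml.
by have := u01 w; have := v01 w; move=> /andP[? ?] /andP[? ?]; apply/andP; split; lra.
Qed.

(** Averages of indicators suffice to approximate functions with values in [0, 1], and being indexed
    by finite sequences of naturals they form a countable family. *)
Definition step_fun (m : nat -> set W) (s : seq nat) (w : W) : R :=
  (\sum_(i <- s) \1_(m i) w) / (size s)%:R.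

(** Layer-cake approximation: the average of the indicators of [{k + 1 <= N * u}] for [k < N] is the
    integer part of [N * u] divided by [N], within [1 / N] of [u]. Each layer is then replaced by a
    nearby [m n], at an average cost of at most [e / 2]. *)
Lemma step_fun_dense (m : nat -> set W) :
  (forall n, measurable (m n)) ->
  (forall E, measurable E -> forall e : R, 0 < e ->
     exists n, (P (E `+` m n) <= e%:E)%E) ->
  forall u : W -> R, measurable_fun setT u -> (forall w, 0 <= u w <= 1) ->
  forall e : R, 0 < e -> exists s, (L1dist P u (step_fun m s) <= e%:E)%E.
Proof.
move=> mm dm u mu u01 e e0.
have [p pe] := pow2_small (divr_gt0 e0 (@ltr0Sn R 1)).
set N := (2 ^ p)%N in pe.
have N0 : 0 < N%:R :> R by rewrite ltr0n expn_gt0.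
pose E k := [set w | k.+1%:R <= N%:R * u w].
have mE k : measurable (E k).
  rewrite -[X in measurable X]setTI; apply: measurable_fun_le => //.
  exact: measurable_funM.
have e2 : 0 < e / 2 by rewrite divr_gt0.
have /choice[c Hc] : forall k, exists n, (P (E k `+` m n) <= (e / 2)%:E)%E.
  by move=> k; exact: dm.
exists [seq c k | k <- iota 0 N].
have key w : `|u w - step_fun m [seq c k | k <- iota 0 N] w| <=
    1 / N%:R + N%:R^-1 * \sum_(k < N) \1_(E k `+` m (c k)) w.
  have -> : step_fun m [seq c k | k <- iota 0 N] w =
      N%:R^-1 * \sum_(k < N) \1_(m (c k)) w.
    rewrite /step_fun size_map size_iota big_map mulrC; congr (_ * _).
    by rewrite -(big_mkord xpredT (fun k => \1_(m (c k)) w)) /index_iota subn0.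
  have uE : `|u w - N%:R^-1 * \sum_(k < N) \1_(E k) w| <= 1 / N%:R.
    have /andP[u0 u1] := u01 w.
    have Nu0 : 0 <= N%:R * u w by rewrite mulr_ge0// ltW.
    have /andP[t1 t2] := truncn_itv Nu0.
    set t := Num.trunc (N%:R * u w) in t1 t2.
    have tN : (t <= N)%N by rewrite -(@ler_nat R) (le_trans t1)// ler_piMr// ltW.
    have -> : \sum_(k < N) (\1_(E k) w : R) = t%:R.
      rewrite (eq_bigr (fun k : 'I_N => ((k < t)%N)%:R)); last first.
        move=> k _; rewrite indicE; congr (_%:R); congr nat_of_bool.
        rewrite /t truncn_ge_nat//.
        by apply/idP/idP; rewrite inE.
      by rewrite -natr_sum sum_ltn_ord (minn_idPr tN).
    rewrite -[u w](mulKf (lt0r_neq0 N0)) -mulrBr normrM ger0_norm ?invr_ge0 ?(ltW N0)//.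
    rewrite -natr1 in t2; rewrite div1r ler_piMr ?invr_ge0 ?(ltW N0)// ler_norml.
    by apply/andP; split; lra.
  apply: le_trans (ler_distD (N%:R^-1 * \sum_(k < N) \1_(E k) w) _ _) _.
  apply: lerD => //; rewrite -mulrBr normrM ger0_norm ?invr_ge0 ?(ltW N0)//.
  rewrite ler_pM2l ?invr_gt0// -sumrB; apply: le_trans (ler_norm_sum _ _ _) _.
  apply: ler_sum => k _; rewrite !indicE.
  case: (pselect (E k w)) => Ew; case: (pselect (m (c k) w)) => mw;
    rewrite ?(mem_set Ew) ?(memNset Ew) ?(mem_set mw) ?(memNset mw)
      ?subrr ?subr0 ?sub0r ?normrN ?normr0 ?normr1 ?ler0n//;
    by rewrite mem_set//; rewrite /setY /=; tauto.
pose f w := \sum_(k < N) (\1_(E k `+` m (c k)) w : R).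
have mS k : measurable (E k `+` m (c k)) by exact: measurable_setY.
have mf : measurable_fun setT f.
  by apply: measurable_sum => k; exact: measurable_indic.
have f0 w : 0 <= f w by apply: sumr_ge0.
apply: (@le_trans _ _ (\int[P]_w ((1 / N%:R)%:E + (N%:R^-1)%:E * (f w)%:E))%E).
  apply: ge0_le_integral => //.
  - apply: measurable_dist => //; rewrite /step_fun; apply: measurable_funM => //.
    by apply: measurable_sum => k; exact: measurable_indic.
  - apply: emeasurable_funD => //; apply: measurable_funeM.
    exact/measurable_EFinP.
  - by move=> w _; rewrite -EFinM -EFinD lee_fin; exact: key.
rewrite ge0_integralD//; last 2 first.
- by move=> w _; rewrite -EFinM lee_fin mulr_ge0 ?invr_ge0 ?(ltW N0).
- by apply: measurable_funeM; exact/measurable_EFinP.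
rewrite [X in (X + _)%E](_ : _ = (1 / N%:R)%:E); last first.
  by rewrite (integral_cst P measurableT) -[RHS]mule1 -(probability_setT P).
rewrite ge0_integralZl//; last 2 first.
- exact/measurable_EFinP.
- by move=> w _; rewrite lee_fin.
have -> : (\int[P]_w (f w)%:E = \sum_(k < N) P (E k `+` m (c k)))%E.
  under eq_integral do rewrite /f -sumEFin.
  rewrite ge0_integral_sum//.
  - by apply: eq_bigr => k _; rewrite integral_indic// setIT.
  - by move=> k; apply/measurable_EFinP; exact: measurable_indic.
apply: (@le_trans _ _ ((e / 2)%:E + N%:R^-1%:E * \sum_(k < N) (e / 2)%:E)%E).
  apply: leeD; first by rewrite lee_fin.
  rewrite lee_pmul2l ?lte_fin ?invr_gt0//.
  by apply: lee_sum => k _; exact: Hc.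
rewrite sumEFin -EFinM -EFinD lee_fin sumr_const card_ord -[X in _ + _ * X]mulr_natr.
rewrite mulrCA mulVf ?lt0r_neq0//; lra.
Qed.

(** The device of [separable_class], with the step functions as dense points: the sequence has to
    stay in [K], for instance in an orbit of the action. *)
Lemma L1_separable_class (K : set (W -> R)) : countably_generated W ->
  K !=set0 -> (forall u, K u -> measurable_fun setT u) ->
  (forall u w, K u -> 0 <= u w <= 1) ->
  exists v : nat -> W -> R, (forall n, K (v n)) /\
    forall u, K u -> forall e : R, 0 < e -> exists n, (L1dist P u (v n) <= e%:E)%E.
Proof.
move=> cW [u0 Ku0] mK K01.
have [m [mm dm]] := countably_generated_separable P cW.
have den := step_fun_dense mm dm.
have ms s : measurable_fun setT (step_fun m s).
  apply: measurable_funM => //.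
  by apply: measurable_sum => k; exact: measurable_indic.
have ex (sk : seq nat * nat) : exists A, K A /\ ((exists2 E, K E &
    (L1dist P E (step_fun m sk.1) <= (1 / (2 ^ sk.2)%:R)%:E)%E) ->
    (L1dist P A (step_fun m sk.1) <= (1 / (2 ^ sk.2)%:R)%:E)%E).
  have [[E KE PE]|nE] := pselect (exists2 E, K E &
    (L1dist P E (step_fun m sk.1) <= (1 / (2 ^ sk.2)%:R)%:E)%E); first by exists E.
  by exists u0.
have [D HD] := choice ex.
exists (fun n => D (odflt ([::], 0%N) (unpickle n))); split.
  by move=> n; exact: (HD _).1.
move=> u Ku e e0; have [k ke] := @pow2_small R _ (divr_gt0 e0 (@ltr0Sn R 1)).
have pk : 0 < 1 / (2 ^ k)%:R :> R by rewrite divr_gt0// ltr0n expn_gt0.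
have [s us] := den u (mK _ Ku) (fun w => K01 u w Ku) _ pk.
exists (pickle (s, k)); rewrite pickleK /=.
have Dn := (HD (s, k)).2 (ex_intro2 _ _ u Ku us).
apply: le_trans (L1dist_triangle P (mK _ Ku) (ms s) (mK _ (HD (s, k)).1)) _.
rewrite [leRHS](_ : _ = (e / 2)%:E + (e / 2)%:E)%E; last by rewrite -EFinD; congr EFin; lra.
apply: leeD; first by apply: le_trans us _; rewrite lee_fin.
by rewrite L1distC; apply: le_trans Dn _; rewrite lee_fin.
Qed.

End L1_separability.

(** * Sections in product spaces *)

Section sections.
Context (R : realType) d1 d2 (X : measurableType d1) (Y : measurableType d2)
  (mu : probability X R) (nu : probability Y R).
Implicit Types D : set (X * Y).

Lemma xsection_pair D x : xsection D x = pair x @^-1` D.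
Proof. by apply/seteqP; split => y; rewrite /xsection /= ?inE. Qed.

Lemma measurable_pair_preimage D x : measurable D -> measurable (pair x @^-1` D).
Proof. by move=> mD; rewrite -xsection_pair; exact: measurable_xsection. Qed.

Lemma measurable_fun_section_measure D : measurable D ->
  measurable_fun setT (fun x => nu (pair x @^-1` D)).
Proof.
move=> mD; have := measurable_fun_xsection nu mD; apply: eq_measurable_fun => x _ /=.
by rewrite xsection_pair.
Qed.

Lemma product_measureE D : measurable D ->
  (mu \x nu)%E D = (\int[mu]_x nu (pair x @^-1` D))%E.
Proof. by move=> mD; apply: eq_integral => x _ /=; rewrite xsection_pair. Qed.

Lemma product_measure_le D (e : R) : measurable D ->
  (\forall x \ae mu, (nu (pair x @^-1` D) <= e%:E)%E) ->
  ((mu \x nu)%E D <= e%:E)%E.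
Proof.
move=> mD He; rewrite product_measureE//.
rewrite -[leRHS]mule1 -(probability_setT mu) -(integral_cst mu measurableT).
apply: ae_ge0_le_integral => //.
- exact: measurable_fun_section_measure.
- have [x Hx] := ae_nonempty He.
  by move=> z _; apply: le_trans Hx; exact: measure_ge0.
- by apply: filterS He => x.
Qed.

Lemma product_measure0 D : measurable D ->
  (\forall x \ae mu, nu (pair x @^-1` D) = 0%E) -> (mu \x nu)%E D = 0%E.
Proof.
move=> mD D0; apply: ge0_small_eq0 => [|e e0]; first exact: measure_ge0.
by apply: product_measure_le => //; apply: filterS D0 => x ->; rewrite lee_fin ltW.
Qed.

Lemma product_ae_sections (p : X * Y -> Prop) :
  (\forall w \ae (mu \x nu)%E, p w) ->
  \forall x \ae mu, \forall y \ae nu, p (x, y).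
Proof.
move=> [N [mN N0 pN]].
have : ae_eq mu setT (fun x => nu (pair x @^-1` N)) (cst 0%E).
  apply/ae_eq_integral_abs => //; first exact: measurable_fun_section_measure.
  by rewrite -[RHS]N0 product_measureE//; apply: eq_integral => x _; rewrite gee0_abs.
apply: filterS => x /(_ Logic.I) /= Nx; exists (pair x @^-1` N); split => //.
  exact: measurable_pair_preimage.
by move=> y py; exact: pN.
Qed.

Lemma setY0_sections D1 D2 : measurable D1 -> measurable D2 ->
  (mu \x nu)%E (D1 `+` D2) = 0%E ->
  \forall x \ae mu, nu (pair x @^-1` D1 `+` pair x @^-1` D2) = 0%E.
Proof.
move=> m1 m2 /(setY0_ae m1 m2)/product_ae_sections; apply: filterS => x Hx.
by apply: ae_setY0 => //; exact: measurable_pair_preimage.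
Qed.

Lemma measure_preserving_fst : measure_preserving (mu \x nu)%E mu fst.
Proof.
split; first exact: measurable_fst.
move=> E mE; rewrite (_ : fst @^-1` E = E `*` setT).
  apply: etrans (product_measure1E mu nu mE measurableT) _.
  by rewrite -[RHS]mule1 -(probability_setT nu).
by apply/seteqP; split => -[x y] //= [].
Qed.

Lemma measure_preserving_snd : measure_preserving (mu \x nu)%E nu snd.
Proof.
split; first exact: measurable_snd.
move=> E mE; rewrite (_ : snd @^-1` E = setT `*` E).
  apply: etrans (product_measure1E mu nu measurableT mE) _.
  by rewrite -[RHS]mul1e -(probability_setT mu).
by apply/seteqP; split => -[x y] //= [].
Qed.

Lemma measurable_fun_section (f : X * Y -> R) x :
  measurable_fun setT f -> measurable_fun setT (fun y => f (x, y)).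
Proof. by move=> mf; apply: measurableT_comp mf _; exact: measurable_pair1. Qed.

Lemma measurable_L1dist_sections (f g : X * Y -> R) : measurable_fun setT f ->
  measurable_fun setT g ->
  measurable_fun setT (fun x => L1dist nu (fun y => f (x, y)) (fun y => g (x, y))).
Proof.
move=> mf mg; apply: (measurable_fun_fubini_tonelli_F (m2 := nu) (fun w => `|f w - g w|%:E)).
  exact: measurable_dist.
by move=> w; rewrite lee_fin.
Qed.

Lemma L1dist_product (f g : X * Y -> R) : measurable_fun setT f ->
  measurable_fun setT g -> L1dist (mu \x nu)%E f g =
  (\int[mu]_x L1dist nu (fun y => f (x, y)) (fun y => g (x, y)))%E.
Proof.
by move=> mf mg; rewrite /L1dist fubini_tonelli1//; exact: measurable_dist.
Qed.

End sections.

(** By Fubini, measure preservation on the base and on almost every fibre suffices, together with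
    joint measurability. It covers skew products, translations of the fibres, product maps and the
    map [(x, y) |-> (x, h (x, y))]. *)
Lemma measure_preserving_fibred (R : realType) d1 d2 d3 d4
    (X : measurableType d1) (Y : measurableType d2) (X' : measurableType d3)
    (Y' : measurableType d4) (mu : probability X R) (nu : probability Y R)
    (mu' : probability X' R) (nu' : probability Y' R) (a : X -> X')
    (b : X -> Y -> Y') :
  measurable_fun setT (fun p : X * Y => (a p.1, b p.1 p.2)) ->
  measure_preserving mu mu' a ->
  (\forall x \ae mu, measure_preserving nu nu' (b x)) ->
  measure_preserving (mu \x nu)%E (mu' \x nu')%E (fun p => (a p.1, b p.1 p.2)).
Proof.
move=> mf mpa mpb; split => // D mD.
have mfD : measurable ((fun p : X * Y => (a p.1, b p.1 p.2)) @^-1` D).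
  by rewrite -[X in measurable X]setTI; exact: mf.
apply: etrans (product_measureE mu nu mfD) _.
apply: etrans (esym (product_measureE mu' nu' mD)).
have mD' := measurable_fun_section_measure nu' mD.
rewrite -(ge0_integral_mp mpa mD'); last by move=> x; exact: measure_ge0.
apply: ae_eq_integral => //.
- exact: (measurable_fun_section_measure nu mfD).
- exact: measurableT_comp mD' mpa.1.
apply: filterS mpb => x [_ Hb] _.
by rewrite -Hb//; exact: measurable_pair_preimage.
Qed.

Lemma eq_probability_rays (R : realType) (P Q : probability R R) :
  (forall a, P [set t | a < t] = Q [set t | a < t]) ->
  forall E, measurable E -> P E = Q E.
Proof.
move=> PQ E mE.
have rayE (a : R) : `]a, +oo[%classic = [set t : R | a < t].
  by apply/seteqP; split => t /=; rewrite in_itv/= andbT.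
have sE : <<s @RGenOInfty.G R >> E.
  have : (@RGenOInfty.G R).-sigma.-measurable E by rewrite -RGenOInfty.measurableE; exact: mE.
  by [].
apply: (g_sigma_algebra_measure_unique (@RGenOInfty.G R) _
  (fun k => `](- k%:R : R), +oo[%classic) _ _ P Q _ _ _ E sE).
- by move=> _ [a ->]; exact: measurable_itv.
- by move=> k; exists (- k%:R).
- apply/seteqP; split => // t _.
  exists (Num.trunc `|t|).+1 => //=; rewrite in_itv/= andbT.
  have /andP[_ H] := truncn_itv (normr_ge0 t).
  by rewrite ltrNl; apply: le_lt_trans H; rewrite -normrN ler_norm.
- move=> _ _ [a ->] [b ->]; exists (Num.max a b).
  by rewrite !rayE; apply/seteqP; split => t /=;
    [rewrite gt_max => -[-> ->]|rewrite gt_max => /andP].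
- by move=> _ [a ->]; rewrite !rayE; exact: PQ.
- by move=> k; rewrite (le_lt_trans (probability_le1 _ _)) ?ltry//; exact: measurable_itv.
Qed.

Section L1_limit_law.
Context (R : realType) d (Y : measurableType d) (nu : probability Y R).

(** Composing with [S] does not change the law of [v], and by Markov [u] exceeds [v \o S] by a fixed
    amount only on a small set. The inequality is one-sided; exchanging the roles of two functions
    approximating each other gives equality of laws. *)
Lemma law_le_of_L1_approx (u v : Y -> R) : measurable_fun setT u ->
  measurable_fun setT v -> (forall e : R, 0 < e -> exists2 S : Y -> Y,
    measure_preserving nu nu S & (L1dist nu (v \o S) u <= e%:E)%E) ->
  forall a, (nu [set y | (a < u y)%R] <= nu [set y | (a < v y)%R])%E.
Proof.
move=> mu mv H a.
have mray f (t : R) : measurable_fun setT f -> measurable [set y : Y | t < f y].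
  move=> mf; rewrite (_ : [set y | _] = setT `&` f @^-1` [set s | t < s]).
    by apply: mf => //; apply: open_measurable; exact: open_gt.
  by rewrite setTI.
(* A margin [n.+1%:R^-1] above [a] makes room for the Markov estimate; it is removed by continuity
   from below. *)
apply: (@le_trans _ _ (nu (\bigcup_n [set y | a + n.+1%:R^-1 < u y]))).
  apply: le_measure; rewrite ?inE; first exact: mray.
    by apply: bigcupT_measurable => n; exact: mray.
  move=> y /= ay; have ay0 : 0 < u y - a by rewrite subr_gt0.
  have [n _ /(_ n (leqnn n)) /= Hn] := near_infty_natSinv_lt (PosNum ay0).
  by exists n => //=; move: Hn; set z := _^-1; lra.
have nd : {homo (fun n => [set y | a + n.+1%:R^-1 < u y]) : n m / (n <= m)%N >-> (n <= m)%O}.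
  move=> n m nm; apply/subsetPset => y /=; apply: le_lt_trans.
  by rewrite lerD2l lef_pV2 ?posrE// ler_nat ltnS.
have cv := nondecreasing_cvg_mu (mu := nu) (fun n => mray u (a + n.+1%:R^-1) mu)
  (bigcupT_measurable _ (fun n => mray u (a + n.+1%:R^-1) mu)) nd.
rewrite -(cvg_lim _ cv)//; apply: lime_le; first by apply/cvg_ex; eexists; exact: cv.
apply: nearW => n /=.
have n0 : 0 < n.+1%:R^-1 :> R by rewrite invr_gt0.
apply/lee_addgt0Pr => e e0.
have [S mpS HS] := H _ (mulr_gt0 n0 e0).
have mvS : measurable_fun setT (v \o S) by apply: measurableT_comp mv mpS.1.
have HL := markov_L1dist mvS mu n0 HS.
have -> : nu [set y | a < v y] = nu [set y | a < (v \o S) y].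
  by rewrite -(mpS.2 [set y | a < v y])//; exact: mray.
apply: le_trans (leeD (lexx _) HL).
have mL : measurable [set w | n.+1%:R^-1 <= `|(v \o S) w - u w|].
  rewrite -[X in measurable X]setTI; apply: measurable_fun_le => //.
  by apply: measurableT_comp => //; exact: measurable_funB.
apply: le_trans (measureU2 _ _ _) => //; last exact: mray.
apply: le_measure; rewrite ?inE; first exact: mray.
  by apply: measurableU => //; exact: mray.
move=> y /= H1; have [av|av] := ltP a (v (S y)); [by left|right].
rewrite /= distrC; apply: le_trans (ler_norm _); move: H1; set z := _^-1; lra.
Qed.

End L1_limit_law.

(** * Rigid functions of skew products *)

Section skew_product_rigidity.
Context (R : realType) dX (X : measurableType dX) (mu : probability X R)
  (T : X -> X) (G : zmodType) (phi : X -> G)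
  dY (Y : measurableType dY) (nu : probability Y R) (S : G -> Y -> Y).
Hypotheses (cX : countably_generated X) (cY : countably_generated Y)
  (mpT : measure_preserving mu mu T) (mmT : mildly_mixing mu T)
  (mpS : forall g, measure_preserving nu nu (S g))
  (S0 : \forall y \ae nu, S 0 y = y)
  (SD : forall g h, \forall y \ae nu, S (g + h) y = S g (S h y))
  (mskew : measurable_fun [set: X * Y] (skew_product T phi S)).

Let W := skew_product T phi S.

Lemma measure_preserving_skew : measure_preserving (mu \x nu)%E (mu \x nu)%E W.
Proof.
apply: (measure_preserving_fibred (b := fun x => S (phi x))) => //.
exact: aeW.
Qed.

Lemma action_comm g k : \forall y \ae nu, S g (S k y) = S k (S g y).
Proof. by apply: filterS2 (SD g k) (SD k g) => y <- <-; rewrite addrC. Qed.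

Lemma action_opp g : \forall y \ae nu, S (- g) (S g y) = y.
Proof. by apply: filterS2 (SD (- g) g) S0 => y <-; rewrite addNr. Qed.

(** The group element is the cocycle sum of [phi] along the orbit of [x]. It is fixed once [x] is,
    so only finitely many of the almost everywhere identities [SD] are invoked on each fibre. *)
Lemma iter_skew n x : exists g,
  \forall y \ae nu, iter n W (x, y) = (iter n T x, S g y).
Proof.
elim: n => [|n [g Hg]].
  by exists 0; apply: filterS S0 => y /= ->.
exists (phi (iter n T x) + g).
by apply: filterS2 Hg (SD (phi (iter n T x)) g) => y /= -> ->.
Qed.

Let act g (p : X * Y) := (p.1, S g p.2).

Lemma measure_preserving_act g :
  measure_preserving (mu \x nu)%E (mu \x nu)%E (act g).
Proof.
apply: (measure_preserving_fibred (a := id) (b := fun=> S g)).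
- apply/measurable_fun_pairP; split => /=; first exact: measurable_fst.
  exact: measurableT_comp (mpS g).1 measurable_snd.
- exact: measure_preserving_id.
- exact: aeW.
Qed.

(** As [G] is Abelian, [act g] commutes with the iterates of [W] almost everywhere, and it preserves
    measure. *)
Lemma rigid_sets_act q g D : rigid_sets (mu \x nu)%E W q D ->
  rigid_sets (mu \x nu)%E W q (act g @^-1` D).
Proof.
move=> [mD cD]; have mpg := measure_preserving_act g.
have mpW n := measure_preserving_iter n measure_preserving_skew.
have mgD : measurable (act g @^-1` D) by exact: mp_measurable mpg mD.
split => // e /cD; apply: filterS => n; congr (_ <= _)%E.
have m1 : measurable (iter (q n) W @^-1` D) by exact: mp_measurable (mpW _) mD.
have m2 : measurable (iter (q n) W @^-1` (act g @^-1` D)).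
  exact: mp_measurable (mpW _) mgD.
have m3 : measurable (act g @^-1` (iter (q n) W @^-1` D)).
  exact: mp_measurable mpg m1.
have m4 := measurable_setY m1 mD.
apply: etrans (esym (mpg.2 _ m4)) _; apply: setY0_measure.
- exact: mp_measurable mpg m4.
- exact: measurable_setY.
apply: product_measure0.
  apply: measurable_setY; last exact: measurable_setY.
  exact: mp_measurable mpg m4.
apply: aeW => x.
(* On the fibre over [x] the iterate acts as the single element [S k], so commutation reduces to
   that of [S g] and [S k]. *)
have [k Hk] := iter_skew (q n) x.
apply: ae_setY0.
- by apply: measurable_pair_preimage; exact: mp_measurable mpg m4.
- by apply: measurable_pair_preimage; exact: measurable_setY.
have Hgk := mp_ae (mpS g) Hk.
apply: filterS3 Hk Hgk (action_comm g k) => y H1 H2 H3.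
by rewrite /setY /preimage /act /= H1 H2 /= H3.
Qed.

Section one_orbit.
Context (h : X * Y -> R) (q : nat -> nat).
Hypotheses (qoo : q n @[n --> \oo] --> \oo) (mh : measurable_fun setT h)
  (h01 : forall p, 0 <= h p <= 1)
  (ch : forall e : R, 0 < e -> \forall n \near \oo,
     (L1dist (mu \x nu)%E (h \o iter (q n) W) h <= e%:E)%E).

Let hx x y := h (x, y).

Let mhx x : measurable_fun setT (hx x).
Proof. exact: measurable_fun_section. Qed.

Let mcomp (u : Y -> R) g : measurable_fun setT u -> measurable_fun setT (u \o S g).
Proof. by move=> mf; apply: measurableT_comp mf (mpS g).1. Qed.

Let orbit_dist (v : Y -> R) x : \bar R :=
  ereal_inf (range (fun g => L1dist nu (hx x) (v \o S g))).

Let orbit_dist_le v x g : (orbit_dist v x <= L1dist nu (hx x) (v \o S g))%E.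
Proof.
by apply: ge_ereal_inf; exists (L1dist nu (hx x) (v \o S g)) => //; exists g.
Qed.

(** The orbit of [v] is invariant under translation, so [hx x'] and [hx x' \o S g] are equally far
    from it, and the distance to a set is 1-Lipschitz. The bounds are written as sums since
    [orbit_dist] takes extended real values. *)
Let orbit_dist_lip (v : Y -> R) x x' g : measurable_fun setT v ->
  (orbit_dist v x' <= L1dist nu (hx x' \o S g) (hx x) + orbit_dist v x)%E /\
  (orbit_dist v x <= L1dist nu (hx x' \o S g) (hx x) + orbit_dist v x')%E.
Proof.
move=> mv.
have fd : L1dist nu (hx x' \o S g) (hx x) \is a fin_num.
  rewrite ge0_fin_numE ?L1dist_ge0// (le_lt_trans (L1dist_le1 _ _ _ _ _)) ?ltry//.
  - exact: mcomp.
  - by move=> y; exact: h01.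
  - by move=> y; exact: h01.
split.
- rewrite addeC -leeBlDr//; apply/ereal_infP => _ [k _ <-].
  (* Translating by [g] turns [v \o S (k - g)] into [v \o S k], which explains the shift by [- g],
     and by [+ g] in the other bound. *)
  rewrite leeBlDr//; apply: (@le_trans _ _ (L1dist nu (hx x') (v \o S (k - g)))).
    exact: orbit_dist_le.
  rewrite -(L1dist_comp (mpS g) (mhx x') (mcomp (k - g) mv)).
  have -> : L1dist nu (hx x' \o S g) ((v \o S (k - g)) \o S g) =
      L1dist nu (hx x' \o S g) (v \o S k).
    apply: eq_L1dist_ae; [exact: mcomp|exact: mcomp|by do 2 apply: mcomp|exact: mcomp|exact: aeW|].
    by apply: filterS (SD (k - g) g) => y /= <-; rewrite subrK.
  by rewrite addeC; apply: L1dist_triangle => //; exact: mcomp.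
- rewrite addeC -leeBlDr//; apply/ereal_infP => _ [k _ <-].
  rewrite leeBlDr//; apply: (@le_trans _ _ (L1dist nu (hx x) (v \o S (k + g)))).
    exact: orbit_dist_le.
  have mxg := mcomp g (mhx x'); have mvk := mcomp (k + g) mv.
  have -> : L1dist nu (hx x') (v \o S k) = L1dist nu (hx x' \o S g) (v \o S (k + g)).
    rewrite -(L1dist_comp (mpS g) (mhx x') (mcomp k mv)).
    apply: eq_L1dist_ae; [exact: mxg|exact: mxg|by do 2 apply: mcomp|exact: mvk|exact: aeW|].
    by apply: filterS (SD k g) => y /= <-.
  by rewrite addeC [X in (X + _)%E]L1distC; exact: L1dist_triangle.
Qed.

Let orbit_dist01 (v : Y -> R) x : measurable_fun setT v -> (forall y, 0 <= v y <= 1) ->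
  (0 <= orbit_dist v x <= 1)%E.
Proof.
move=> mv v01; apply/andP; split.
  by apply/ereal_infP => _ [g _ <-]; exact: L1dist_ge0.
apply: (@le_trans _ _ (L1dist nu (hx x) (v \o S 0))).
  exact: orbit_dist_le.
apply: L1dist_le1 => //; first exact: mcomp.
  by move=> y; exact: h01.
by move=> y; exact: v01.
Qed.

(** The group need not be countable, but its orbit of [v] is separable in L1(nu), so the infimum may
    be taken over a sequence in the orbit. *)
Let measurable_orbit_dist (v : Y -> R) : measurable_fun setT v -> (forall y, 0 <= v y <= 1) ->
  measurable_fun setT (orbit_dist v).
Proof.
move=> mv v01.
have [w [Kw dw]] := L1_separable_class nu (K := range (fun g => v \o S g)) cY
  (ex_intro _ _ (ex_intro2 _ _ 0 Logic.I erefl))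
  (fun u '(ex_intro2 g _ E) => let: erefl := E in mcomp g mv)
  (fun u y '(ex_intro2 g _ E) => let: erefl := E in v01 (S g y)).
have mw n : measurable_fun setT (w n) by have [g _ <-] := Kw n; exact: mcomp.
have -> : orbit_dist v = (fun x => ereal_inf (range (fun n => L1dist nu (hx x) (w n)))).
  apply/funext => x; apply/eqP; rewrite eq_le; apply/andP; split.
    apply/ereal_infP => _ [n _ <-]; have [g _ <-] := Kw n.
    exact: orbit_dist_le.
  apply/ereal_infP => _ [g _ <-]; apply/lee_addgt0Pr => e e0.
  have [n Hn] := dw (v \o S g) (ex_intro2 _ _ g Logic.I erefl) e e0.
  apply: (@le_trans _ _ (L1dist nu (hx x) (w n))).
    by apply: ge_ereal_inf; exists (L1dist nu (hx x) (w n)) => //; exists n.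
  apply: le_trans (L1dist_triangle (v := v \o S g) _ _ _ _) _ => //; first exact: mcomp.
  by rewrite leeD.
have -> : (fun x => ereal_inf (range (fun n => L1dist nu (hx x) (w n)))) =
    (fun x => einfs (fun n => L1dist nu (hx x) (w n)) 0%N).
  apply/funext => x; rewrite /einfs /sdrop; congr ereal_inf.
  by apply/seteqP; split => _ [n _ <-]; exists n.
apply: measurable_fun_einfs => n.
have mwn : measurable_fun setT (fun p : X * Y => w n p.2).
  exact: measurableT_comp (mw n) measurable_snd.
exact: (measurable_L1dist_sections nu mh mwn).
Qed.

(** By the Lipschitz bound, the change of [orbit_dist v] from [x] to [iter (q n) T x] is at most the
    L1 distance of [h \o iter (q n) W] and [h] on the fibre over [x]. Integrating over [x] makes
    [orbit_dist v] rigid for [T] along [q]. *)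
Lemma orbit_dist_const (v : Y -> R) : measurable_fun setT v -> (forall y, 0 <= v y <= 1) ->
  exists c, \forall x \ae mu, orbit_dist v x = c.
Proof.
move=> mv v01.
have od01 x : (0 <= orbit_dist v x <= 1)%E by exact: orbit_dist01.
have fod x : orbit_dist v x \is a fin_num.
  have /andP[lo hi] := od01 x.
  by rewrite ge0_fin_numE// (le_lt_trans hi)// ltry.
have modist : measurable_fun setT (fun x => fine (orbit_dist v x)).
  by apply: measurableT_comp => //; exact: measurable_orbit_dist.
have [c Hc] : exists c, \forall x \ae mu, fine (orbit_dist v x) = c.
  apply: (mildly_mixing_rigid_fun cX mpT mmT qoo modist).
    move=> x; have /andP[lo hi] := od01 x.
    by rewrite fine_ge0//= -lee_fin fineK.
  move=> e /ch; apply: filterS => n; apply: le_trans.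
  have mpWn := measure_preserving_iter (q n) measure_preserving_skew.
  have mhW : measurable_fun setT (h \o iter (q n) W) by apply: measurableT_comp mh mpWn.1.
  rewrite L1dist_product//.
  apply: ge0_le_integral => //.
  - apply: measurable_dist => //.
    by apply: measurableT_comp modist _; exact: (measure_preserving_iter (q n) mpT).1.
  - exact: measurable_L1dist_sections.
  move=> x _.
  have [k Hk] := iter_skew (q n) x.
  have -> : L1dist nu (fun y => (h \o iter (q n) W) (x, y)) (fun y => h (x, y)) =
      L1dist nu (hx (iter (q n) T x) \o S k) (hx x).
    apply: eq_L1dist_ae; [exact: measurable_fun_section|exact: mcomp
      |exact: mhx|exact: mhx| |exact: aeW].
    by apply: filterS Hk => y /= ->.
  have [l1 l2] := orbit_dist_lip x (iter (q n) T x) k mv.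
  set a := L1dist _ _ _ in l1 l2 *.
  have fa : a \is a fin_num.
    rewrite ge0_fin_numE ?L1dist_ge0// (le_lt_trans (L1dist_le1 _ _ _ _ _)) ?ltry//.
    - exact: mcomp.
    - by move=> y; exact: h01.
    - by move=> y; exact: h01.
  move: l1 l2; rewrite /= -(fineK fa) -(fineK (fod x)) -(fineK (fod (iter (q n) T x))).
  rewrite -!EFinD !lee_fin => l1 l2.
  by rewrite ler_norml; apply/andP; split; lra.
by exists c%:E; apply: filterS Hc => x <-; rewrite fineK.
Qed.

(** For a dense sequence [v n], almost every fibre has the same distance [c n] to the orbit of each
    [v n]. If [v n] is close to [hx x], then [c n] is small, so [hx x'] is also close to the orbit
    of [v n], and hence a translate of it is close to [hx x]. *)
Lemma essentially_one_orbit : exists X0 : set X, (\forall x \ae mu, X0 x) /\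
  forall x x', X0 x -> X0 x' -> forall e : R, 0 < e ->
    exists g, (L1dist nu (hx x' \o S g) (hx x) <= e%:E)%E.
Proof.
pose K := [set v : Y -> R | measurable_fun setT v /\ forall y, 0 <= v y <= 1].
have [v [Kv dv]] : exists v : nat -> Y -> R, (forall n, K (v n)) /\
    forall u, K u -> forall e : R, 0 < e -> exists n, (L1dist nu u (v n) <= e%:E)%E.
  apply: L1_separable_class => //.
  - by exists (cst 0); split => //= y; rewrite lexx ler01.
  - by move=> u [].
  - by move=> u y [_].
have /choice[c Hc] : forall n, exists c, \forall x \ae mu, orbit_dist (v n) x = c.
  by move=> n; apply: orbit_dist_const; have [] := Kv n.
exists [set x | forall n, orbit_dist (v n) x = c n]; split.
  exact: ae_foralln.
move=> x x' Hx Hx' e e0.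
have e4 : 0 < e / 4 by rewrite divr_gt0.
have [n Hn] := dv (hx x) (conj (mhx x) (fun y => h01 (x, y))) _ e4.
have [mv v01] := Kv n.
have : (orbit_dist (v n) x' < (e / 2)%:E)%E.
  rewrite Hx' -(Hx n); apply: (@le_lt_trans _ _ (e / 4)%:E); last by rewrite lte_fin; lra.
  apply: le_trans Hn.
  have -> : L1dist nu (hx x) (v n) = L1dist nu (hx x) (v n \o S 0).
    apply: eq_L1dist_ae; [exact: mhx|exact: mhx|exact: mv|exact: mcomp|exact: aeW|].
    by apply: filterS S0 => y /= ->.
  exact: orbit_dist_le.
(* If [hx x'] is close to [v n \o S g], its translate by [- g] is equally close to [v n]. *)
move=> /ereal_inf_lt[_ [g _ <-] /ltW Hg]; exists (- g).
apply: le_trans (L1dist_triangle (v := v n) _ _ _ _) _ => //; first exact: mcomp.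
rewrite [leRHS](_ : _ = (e / 2)%:E + (e / 2)%:E)%E; last by rewrite -EFinD; congr EFin; lra.
apply: leeD; last by rewrite L1distC; apply: le_trans Hn _; rewrite lee_fin; lra.
apply: le_trans Hg.
rewrite -(L1dist_comp (mpS g) (mcomp (- g) (mhx x')) mv).
suff -> : L1dist nu ((hx x' \o S (- g)) \o S g) (v n \o S g) =
    L1dist nu (hx x') (v n \o S g) by [].
apply: eq_L1dist_ae; [by do 2 apply: mcomp|exact: mhx|exact: mcomp|exact: mcomp| |exact: aeW].
by apply: filterS (action_opp g) => y /= ->.
Qed.

End one_orbit.

End skew_product_rigidity.

(** * Product automorphisms and gluing of fibrewise approximations *)

Lemma automorphism_product (R : realType) d1 d2 (X : measurableType d1)
    (Y : measurableType d2) (mu : probability X R) (nu : probability Y R)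
    (T : X -> X) (U : Y -> Y) : automorphism mu T -> automorphism nu U ->
  automorphism (mu \x nu)%E (product_map T U).
Proof.
move=> [mpT [T' [mpT' T'T TT']]] [mpU [U' [mpU' U'U UU']]].
have mp f g : measure_preserving mu mu f -> measure_preserving nu nu g ->
    measure_preserving (mu \x nu)%E (mu \x nu)%E (product_map f g).
  move=> mpf mpg; apply: (measure_preserving_fibred (b := fun=> g)) => //.
    apply/measurable_fun_pairP; split => /=.
      exact: measurableT_comp mpf.1 measurable_fst.
    exact: measurableT_comp mpg.1 measurable_snd.
  exact: aeW.
split; first exact: mp.
exists (product_map T' U'); split; first exact: mp.
- have H1 := mp_ae (measure_preserving_fst mu nu) T'T.
  have H2 := mp_ae (measure_preserving_snd mu nu) U'U.
  by apply: filterS2 H1 H2 => -[x y]; rewrite /product_map /= => -> ->.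
- have H1 := mp_ae (measure_preserving_fst mu nu) TT'.
  have H2 := mp_ae (measure_preserving_snd mu nu) UU'.
  by apply: filterS2 H1 H2 => -[x y]; rewrite /product_map /= => -> ->.
Qed.

(** Replaces a measurable selection: the sets [B n] are made disjoint, and over the piece number [n]
    the set [H n] is used. The resulting set is in [K] because [K] contains all cylinders over
    [X]. *)
Lemma glue_sections (R : realType) d1 d2 (X : measurableType d1)
    (Y : measurableType d2) (mu : probability X R) (nu : probability Y R)
    (K : set (set (X * Y))) (X0 : set X) (B : nat -> set X)
    (H : nat -> set (X * Y)) (D : set (X * Y)) (e : R) :
  sigma_algebra [set: X * Y] K -> K `<=` measurable ->
  (forall C, measurable C -> K (C `*` [set: Y])) -> (forall n, K (H n)) ->
  (forall n, measurable (B n)) -> measurable D -> (\forall x \ae mu, X0 x) ->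
  (forall x, X0 x -> exists n, B n x) ->
  (forall n x, X0 x -> B n x ->
     (nu (pair x @^-1` D `+` pair x @^-1` H n) <= e%:E)%E) ->
  exists2 D', K D' & ((mu \x nu)%E (D `+` D') <= e%:E)%E.
Proof.
move=> sK Km KX KH mB mD aX0 covB DH.
pose C := seqDU B.
have mC n : measurable (C n) by exact: seqDU_measurable.
have KCH n : K ((C n `*` setT) `&` H n).
  by apply: sigma_algebra_setI => //; exact: KX.
have [_ _ KU] := sK.
have KD' : K (\bigcup_n ((C n `*` setT) `&` H n)) by exact: KU.
exists (\bigcup_n ((C n `*` setT) `&` H n)) => //.
apply: product_measure_le; first by apply: measurable_setY => //; exact: Km.
apply: filterS aX0 => x Xx.
have [n _ Cnx] : (\bigcup_n C n) x.
  by rewrite -seqDU_bigcup_eq; have [n Bnx] := covB _ Xx; exists n.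
have Bnx : B n x by case: Cnx.
have -> : pair x @^-1` (D `+` \bigcup_n ((C n `*` setT) `&` H n)) =
    pair x @^-1` D `+` pair x @^-1` H n; last exact: DH.
rewrite preimage_setY; congr (_ `+` _); apply/seteqP; split => y.
  move=> [m _ [[/= Cmx _] Hm]].
  suff -> : n = m by [].
  by apply: (@trivIset_seqDU _ B n m) => //; exists x.
by move=> Hn; exists n.
Qed.

(** * The invariant factor of the fibre *)

Section rigid_quotient.
Context (R : realType) dX (X : measurableType dX) (mu : probability X R)
  (T : X -> X) (G : zmodType) (phi : X -> G)
  dY (Y : measurableType dY) (nu : probability Y R) (S : G -> Y -> Y).
Hypotheses (stdX : standard_borel R X) (stdY : standard_borel R Y)
  (autT : automorphism mu T) (mmT : mildly_mixing mu T)
  (mpS : forall g, measure_preserving nu nu (S g))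
  (S0 : \forall y \ae nu, S 0 y = y)
  (SD : forall g h, \forall y \ae nu, S (g + h) y = S g (S h y))
  (mskew : measurable_fun [set: X * Y] (skew_product T phi S)).

Let W := skew_product T phi S.
Let P : probability (X * Y)%type R := (mu \x nu)%E.
Let cX : countably_generated X := standard_borel_countably_generated stdX.
Let cY : countably_generated Y := standard_borel_countably_generated stdY.
Let mpT : measure_preserving mu mu T := autT.1.
Let mpW : measure_preserving P P W := measure_preserving_skew mpT mpS mskew.

Context (q : nat -> nat) (h : X * Y -> R) (lambda : probability R R).
Hypotheses (qoo : q n @[n --> \oo] --> \oo) (mph : measure_preserving P lambda h)
  (h01 : forall p, 0 <= h p <= 1)
  (Zh : forall E : set R, measurable E -> rigid_sets P W q (h @^-1` E))
  (dh : forall D, rigid_sets P W q D -> exists2 F : set R, measurable F &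
     P (D `+` h @^-1` F) = 0%E).

Let hx x y := h (x, y).

Let mhx x : measurable_fun setT (hx x).
Proof. exact: measurable_fun_section mph.1. Qed.

Let mhxE x (E : set R) : measurable E -> measurable (hx x @^-1` E).
Proof. by move=> mE; rewrite -[X in measurable X]setTI; exact: mhx. Qed.

Let mSE g (E : set Y) : measurable E -> measurable (S g @^-1` E).
Proof. exact: mp_measurable (mpS g). Qed.

Lemma fibres_one_orbit : exists X0 : set X, (\forall x \ae mu, X0 x) /\
  forall x x', X0 x -> X0 x' -> forall e : R, 0 < e ->
    exists g, (L1dist nu (hx x' \o S g) (hx x) <= e%:E)%E.
Proof.
apply: (essentially_one_orbit cX cY mpT mmT mpS S0 SD mskew qoo mph.1 h01).
have mpWn n := measure_preserving_iter (q n) mpW.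
apply: (converging_sets_L1 (P := P)) => //.
- by move=> n; apply: measurableT_comp mph.1 (mpWn n).1.
- exact: mph.1.
- by move=> n p; exact: h01.
- by move=> E mE; split => //; exact: (Zh mE).2.
Qed.

Section on_orbit.
Context (X0 : set X).
Hypotheses (aX0 : \forall x \ae mu, X0 x)
  (orbX0 : forall x x', X0 x -> X0 x' -> forall e : R, 0 < e ->
    exists g, (L1dist nu (hx x' \o S g) (hx x) <= e%:E)%E).

(** Fibres over [X0] approximate each other by translates, so they share one law; [lambda] is the
    average over [x] of the laws of the fibres, hence equal to it. *)
Lemma fibre_law x : X0 x -> measure_preserving nu lambda (hx x).
Proof.
move=> Xx; split; first exact: mhx.
have [Q mpQ] := image_probability nu (mhx x).
have mray (a : R) : measurable [set t : R | a < t].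
  by apply: open_measurable; exact: open_gt.
have le_ray x1 x2 a : X0 x1 -> X0 x2 ->
    (nu [set y | (a < hx x1 y)%R] <= nu [set y | (a < hx x2 y)%R])%E.
  move=> X1 X2; apply: law_le_of_L1_approx => // e e0.
  by have [g Hg] := orbX0 X1 X2 e0; exists (S g).
move=> E mE; rewrite mpQ.2//; apply: eq_probability_rays mE => a.
rewrite -(mpQ.2 _ (mray a)) -(mph.2 _ (mray a)).
have mha := mp_measurable mph (mray a).
apply/esym; apply: etrans (product_measureE mu nu mha) _.
transitivity (\int[mu]_x' (cst (nu (hx x @^-1` [set t | (a < t)%R])) x'))%E.
  apply: ae_eq_integral => //; first exact: (measurable_fun_section_measure nu mha).
  apply: filterS aX0 => x' X' _ /=; apply/eqP; rewrite eq_le.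
  by apply/andP; split; exact: le_ray.
by rewrite (integral_cst mu measurableT) -[RHS]mule1 -(probability_setT mu).
Qed.

(** Upgrades L1 approximation by translates to convergence of the preimages of every Borel set,
    which is legitimate because all functions involved have law [lambda]. *)
Lemma orbit_approx x x' : X0 x -> X0 x' -> exists g : nat -> G,
  forall E, measurable E -> converging_sets nu (fun n => hx x' \o S (g n)) (hx x) E.
Proof.
move=> Xx Xx'.
have pos n : 0 < 1 / (2 ^ n)%:R :> R by rewrite divr_gt0// ltr0n expn_gt0.
have /choice[g Hg] n := orbX0 Xx Xx' (pos n).
exists g; apply: (converging_sets_law (Q := lambda)).
- by move=> n; exact: measure_preserving_comp (mpS (g n)) (fibre_law Xx').
- exact: fibre_law.
move=> e e0; have [n ne] := pow2_small e0.
exists n => // m /= nm; apply: le_trans (Hg m) _; rewrite lee_fin.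
apply: le_trans ne; rewrite !div1r lef_pV2 ?posrE ?ltr0n ?expn_gt0//.
by rewrite ler_nat leq_pexp2l.
Qed.

(** The point is that one [F] serves every [x] in [X0]. The translate of the rigid set [h @^-1]
    E[is rigid, hence of the form]h @^-1[F] modulo null sets; this relation holds on some fibre over
    [X0] and extends to all the others by approximation. *)
Lemma fibre_invariant g (E : set R) : measurable E -> exists2 F : set R,
  measurable F & forall x, X0 x ->
    nu (S g @^-1` (hx x @^-1` E) `+` hx x @^-1` F) = 0%E.
Proof.
move=> mE.
have Zg := rigid_sets_act mpT mpS S0 SD mskew g (Zh mE).
have [F mF PF] := dh Zg; exists F => // x Xx.
(* The relation on the fibre [x1] passes to the translates [hx x1 \o S (k n)], since these commute
   with [S g], and then to their limit [hx x]. *)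
have [x1 [X1 H1]] : exists x1, X0 x1 /\
    nu (S g @^-1` (hx x1 @^-1` E) `+` hx x1 @^-1` F) = 0%E.
  apply: (ae_nonempty (P := mu)).
  have := setY0_sections (rigid_sets_measurable Zg) (mp_measurable mph mF) PF.
  by apply: filterS2 aX0 => x1.
have [k Hk] := orbit_approx Xx X1.
apply: ge0_small_eq0; first exact: measure_ge0.
move=> e e0; have e2 : 0 < e / 2 by rewrite divr_gt0.
have [n _ /(_ n (leqnn n)) /= [Hn Hn']] := filterI ((Hk E mE).2 _ e2) ((Hk F mF).2 _ e2).
set v := hx x1 \o S (k n) in Hn Hn'.
have mv : measurable_fun setT v by apply: measurableT_comp (mhx x1) (mpS _).1.
have mvE (C : set R) : measurable C -> measurable (v @^-1` C).
  by move=> mC; rewrite -[X in measurable X]setTI; exact: mv.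
apply: (setY_triangle_le (B := S g @^-1` (v @^-1` E)) (a := e / 2) (b := e / 2)).
- exact/mSE/mhxE.
- exact/mSE/mvE.
- exact: mhxE.
- by lra.
- rewrite -preimage_setY (mpS g).2; first by rewrite setYC.
  by apply: measurable_setY; [exact: mhxE|exact: mvE].
apply: (setY_triangle_le (B := v @^-1` F) (a := 0) (b := e / 2)) => //.
- exact/mSE/mvE.
- exact: mvE.
- exact: mhxE.
- by rewrite add0r.
have -> : nu (S g @^-1` (v @^-1` E) `+` v @^-1` F) = 0%E => //.
have m1 : measurable (S g @^-1` (hx x1 @^-1` E)) by exact/mSE/mhxE.
have m2 : measurable (hx x1 @^-1` F) by exact: mhxE.
apply: ae_setY0; [exact/mSE/mvE|exact: mvE|].
have H2 := mp_ae (mpS (k n)) (setY0_ae m1 m2 H1).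
apply: filterS2 H2 (action_comm SD g (k n)) => y H2 H3.
by rewrite -[_ @^-1` F in X in _ <-> X]/(v @^-1` F); move: H2; rewrite /v /preimage /= H3.
Qed.

Section base_fibre.
Context (x0 : X).
Hypothesis Xx0 : X0 x0.

Let A := preimage_set_system [set: Y] (hx x0) measurable.

Lemma base_fibre_sigma_algebra : sigma_algebra [set: Y] A.
Proof. exact: sigma_algebra_preimage (sigma_algebra_measurable _). Qed.

Lemma base_fibre_measurable : A `<=` measurable.
Proof. by move=> _ [E mE <-]; rewrite setTI; exact: mhxE. Qed.

Lemma base_fibre_factor g : factor nu (S g) A.
Proof.
split; [exact: base_fibre_sigma_algebra|exact: base_fibre_measurable|split].
  move=> _ [_ [E mE <-] <-]; rewrite !setTI.
  have [F mF HF] := fibre_invariant g mE.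
  by exists (hx x0 @^-1` F); [exists F; rewrite ?setTI|exact: HF].
move=> _ [E mE <-]; rewrite setTI.
(* Invariance under [- g] shows that every member of [A] is a preimage under [S g] of a member. *)
have [F mF HF] := fibre_invariant (- g) mE.
exists (S g @^-1` (hx x0 @^-1` F)).
  exists (hx x0 @^-1` F); last by rewrite setTI.
  by exists F; rewrite ?setTI.
have mE' := mhxE x0 mE; have mF' := mhxE x0 mF.
have mgE := mSE g (mSE (- g) mE').
apply: (setY0_trans (B := S g @^-1` (S (- g) @^-1` (hx x0 @^-1` E)))) => //.
- exact: mSE.
- apply: ae_setY0 => //.
  by apply: filterS (action_opp S0 SD g) => y; rewrite /preimage /= => ->.
- rewrite -preimage_setY (mpS g).2; first exact: HF.
  by apply: measurable_setY => //; exact: mSE.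
Qed.

(** The approximating translate of [hx x0] depends on [x], but by separability of the measure
    algebra it may be taken from one sequence, independent of [x]. This gives the countable cover
    needed for gluing. *)
Lemma fibre_cover (E : set R) (e : R) : measurable E -> 0 < e ->
  exists g : nat -> G, forall x, X0 x ->
    exists n, (nu (hx x @^-1` E `+` S (g n) @^-1` (hx x0 @^-1` E)) <= e%:E)%E.
Proof.
move=> mE e0; have mE' := mhxE x0 mE.
have [|_ [g _ <-]|D [KD dD]] := separable_class nu
    (K := range (fun g => S g @^-1` (hx x0 @^-1` E))) cY.
- by exists (S 0 @^-1` (hx x0 @^-1` E)); exists 0.
- exact: mSE.
have /choice[g Hg] : forall n, exists g, S g @^-1` (hx x0 @^-1` E) = D n.
  by move=> n; have [g _ <-] := KD n; exists g.
exists g => x Xx; have [k Hk] := orbit_approx Xx Xx0.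
have e2 : 0 < e / 2 by rewrite divr_gt0.
have [m _ /(_ m (leqnn m)) /= Hm] := (Hk E mE).2 _ e2.
have [|n Hn] := dD (S (k m) @^-1` (hx x0 @^-1` E)) _ _ e2; first by exists (k m).
exists n; rewrite Hg.
apply: (setY_triangle_le (B := S (k m) @^-1` (hx x0 @^-1` E)) (a := e / 2) (b := e / 2)) => //.
- exact: mhxE.
- exact: mSE.
- by rewrite -Hg; exact: mSE.
- by lra.
- by rewrite setYC.
Qed.

Let pi (p : X * Y) := (p.1, h p).

Lemma measurable_graph : measurable_fun setT pi.
Proof.
by apply/measurable_fun_pairP; split => /=; [exact: measurable_fst|exact: mph.1].
Qed.

Lemma measurable_fibre_set (E : set R) (C : set Y) (e : R) : measurable E ->
  measurable C -> measurable [set x | (nu (hx x @^-1` E `+` C) <= e%:E)%E].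
Proof.
move=> mE mC.
have mD : measurable (h @^-1` E `+` setT `*` C).
  by apply: measurable_setY; [exact: mp_measurable mph mE|exact: measurableX].
have := emeasurable_fun_infty_c measurableT (measurable_fun_section_measure nu mD) e%:E.
rewrite setTI; congr (measurable _); apply/funext => x /=.
by rewrite preimage_setY (_ : pair x @^-1` (setT `*` C) = C)//;
  apply/seteqP; split => y //= [].
Qed.

Let K1 : set (set (X * Y)) := tensor_left X A.
Let K2 : set (set (X * Y)) := preimage_set_system [set: X * Y] pi measurable.

Let sK1 : sigma_algebra [set: X * Y] K1.
Proof. exact: smallest_sigma_algebra. Qed.

Let sK2 : sigma_algebra [set: X * Y] K2.
Proof. exact: sigma_algebra_preimage (sigma_algebra_measurable _). Qed.

Let mK1 : K1 `<=` measurable.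
Proof.
apply: sigma_generated_ind; first exact: sigma_algebra_measurable.
by move=> _ [E [F [mE AF ->]]]; apply: measurableX => //; exact: base_fibre_measurable.
Qed.

Let mK2 : K2 `<=` measurable.
Proof. by move=> _ [D mD <-]; exact: measurable_graph. Qed.

Let cyl1 C : measurable C -> K1 (C `*` [set: Y]).
Proof.
move=> mC; apply: sub_sigma_algebra; exists C, setT; split => //.
exact: sigma_algebra_setT base_fibre_sigma_algebra.
Qed.

Let cyl2 C : measurable C -> K2 (C `*` [set: Y]).
Proof.
move=> mC; exists (C `*` [set: R]); first exact: measurableX.
by rewrite setTI; apply/seteqP; split => -[x y].
Qed.

Let pair_hx x E : pair x @^-1` (h @^-1` E) = hx x @^-1` E.
Proof. by []. Qed.

Let pair_cyl x (C : set Y) : pair x @^-1` ([set: X] `*` C) = C.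
Proof. by apply/seteqP; split => y //= []. Qed.

Lemma graph_sub_tensor (E : set R) : measurable E -> mem_ae P K1 (h @^-1` E).
Proof.
move=> mE; apply: mem_ae_closed => //; first exact: mp_measurable mph mE.
move=> e e0; have [g Hg] := fibre_cover mE e0.
have /choice[F HF] n : exists F : set R, measurable F /\ forall x, X0 x ->
    nu (S (g n) @^-1` (hx x @^-1` E) `+` hx x @^-1` F) = 0%E.
  by have [F mF HF] := fibre_invariant (g n) mE; exists F.
pose B n := [set x | (nu (hx x @^-1` E `+` S (g n) @^-1` (hx x0 @^-1` E)) <= e%:E)%E].
apply: (glue_sections (X0 := X0) (B := B) (H := fun n => setT `*` (hx x0 @^-1` F n))) => //.
- move=> n; apply: sub_sigma_algebra; exists setT, (hx x0 @^-1` F n); split => //.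
  by exists (F n); rewrite ?setTI//; exact: (HF n).1.
- by move=> n; apply: measurable_fibre_set => //; apply/mSE/mhxE.
- exact: mp_measurable mph mE.
move=> n x Xx Bnx; rewrite pair_hx pair_cyl.
have mF := (HF n).1.
apply: (setY_triangle_le (B := S (g n) @^-1` (hx x0 @^-1` E)) (a := e) (b := 0)) => //.
- exact: mhxE.
- exact/mSE/mhxE.
- exact: mhxE.
- by rewrite addr0.
- by rewrite (HF n).2.
Qed.

Lemma tensor_sub_graph (E : set R) : measurable E ->
  mem_ae P K2 (setT `*` (hx x0 @^-1` E)).
Proof.
move=> mE; have mE' := mhxE x0 mE; apply: mem_ae_closed => //; first exact: measurableX.
move=> e e0; have [g Hg] := fibre_cover mE e0.
have /choice[F HF] n : exists F : set R, measurable F /\ forall x, X0 x ->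
    nu (S (- g n) @^-1` (hx x @^-1` E) `+` hx x @^-1` F) = 0%E.
  by have [F mF HF] := fibre_invariant (- g n) mE; exists F.
pose B n := [set x | (nu (hx x @^-1` E `+` S (g n) @^-1` (hx x0 @^-1` E)) <= e%:E)%E].
apply: (glue_sections (X0 := X0) (B := B) (H := fun n => h @^-1` F n)) => //.
- move=> n; exists (setT `*` F n); first by apply: measurableX => //; exact: (HF n).1.
  by rewrite setTI; apply/seteqP; split => -[x y] //= [].
- by move=> n; apply: measurable_fibre_set => //; apply/mSE.
- exact: measurableX.
move=> n x Xx Bnx; rewrite pair_hx pair_cyl.
have mF := (HF n).1; have mxE := mhxE x mE.
have mxF := mhxE x mF.
apply: (setY_triangle_le (B := S (- g n) @^-1` (hx x @^-1` E)) (a := e) (b := 0)) => //.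
- exact: mSE.
- by rewrite addr0.
(* Pulling back by [S (g n)] cancels the translation by [- g n] and leaves the estimate that defines
   [B n]. *)
- rewrite -(mpS (g n)).2; last by apply: measurable_setY => //; exact: mSE.
  rewrite preimage_setY setYC.
  rewrite (_ : nu _ = nu (hx x @^-1` E `+` S (g n) @^-1` (hx x0 @^-1` E)))//.
  have m1 := mSE (g n) (mSE (- g n) mxE); have m2 := mSE (g n) mE'.
  apply: setY0_measure; [exact: measurable_setY|exact: measurable_setY|].
  apply: ae_setY0; [exact: measurable_setY|exact: measurable_setY|].
  apply: filterS (action_opp S0 SD (g n)) => y.
  by rewrite /setY /preimage /= => ->.
- by rewrite (HF n).2.
Qed.

Lemma graph_tensor : ae_equal P K2 K1.
Proof.
have sM1 := mem_ae_sigma_algebra P sK1 mK1.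
have sM2 := mem_ae_sigma_algebra P sK2 mK2.
split.
- move=> _ [D mD <-]; rewrite setTI.
  suff [] : [set D | measurable (pi @^-1` D) /\ mem_ae P K1 (pi @^-1` D)] D by [].
  move: D mD; rewrite measurable_prod_measurableType.
  apply: sigma_generated_ind; first exact: (sigma_algebra_preim pi sM1).
  move=> _ [C mC [E mE <-]] /=.
  rewrite (_ : pi @^-1` _ = (C `*` [set: Y]) `&` h @^-1` E); last first.
    by apply/seteqP; split => -[x y] /=; rewrite /pi /=; tauto.
  apply: (sigma_algebra_setI sM1) => /=; split.
  + exact: measurableX.
  + by exists (C `*` setT); [exact: cyl1|rewrite setYK measure0].
  + exact: mp_measurable mph mE.
  + exact: graph_sub_tensor.
- move=> D KD; suff [] : [set D | measurable D /\ mem_ae P K2 D] D by [].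
  move: D KD; apply: sigma_generated_ind => //.
  move=> _ [C [_ [mC [E mE <-] ->]]]; rewrite setTI.
  rewrite (_ : C `*` _ = (C `*` [set: Y]) `&` ([set: X] `*` (hx x0 @^-1` E))); last first.
    by apply/seteqP; split => -[x y] /=; tauto.
  apply: (sigma_algebra_setI sM2) => /=; split.
  + exact: measurableX.
  + by exists (C `*` setT); [exact: cyl2|rewrite setYK measure0].
  + by apply: measurableX => //; exact: mhxE.
  + exact: tensor_sub_graph.
Qed.

(** The quotient by [A] is modelled by the real line with law [lambda] and map [hx x0], and the
    quotient by the product sigma-algebra by [X * R] with map [pi]. In the second model the
    restriction of the skew product is literally [product_map T U]. *)
Lemma quotient_isomorphic (U : R -> R) (F : set R) : automorphism lambda U ->
  (\forall p \ae P, h (W p) = U (h p)) -> rigid lambda U ->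
  measurable F -> (0 < lambda F < 1)%E ->
  exists A : set (set Y),
    [/\ forall g, factor nu (S g) A,
        nontrivial nu A &
        exists (Q : quotient_space nu A) (U : Q -> Q),
          [/\ automorphism (quo_prob Q) U,
              ~ mildly_mixing (quo_prob Q) U &
              exists (Q' : quotient_space (mu \x nu)%E (tensor_left X A))
                     (V : Q' -> Q'),
                restriction (skew_product T phi S) V /\
                isomorphic (quo_prob Q') V
                  (mu \x quo_prob Q)%E (product_map T U)]].
Proof.
move=> autU hW rU mF F01.
exists A; split.
- exact: base_fibre_factor.
- exists (hx x0 @^-1` F); first by exists F; rewrite ?setTI.
  by rewrite (fibre_law Xx0).2.
have eA : ae_equal nu (preimage_set_system [set: Y] (hx x0) measurable) A.
  by split=> E AE; exists E => //; rewrite setYK measure0.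
exists (QuotientSpace (standard_borel_R R) (fibre_law Xx0) eA), U; split => //=.
  apply: (not_mildly_mixing_factor (@standard_borel_R R) _ autU autU.1 _ rU mF F01).
    exact: measure_preserving_id.
  exact: aeW.
have mppi : measure_preserving (mu \x nu)%E (mu \x lambda)%E pi.
  have pE : pi = (fun p => (id p.1, hx p.1 p.2)) by apply/funext => -[x y].
  rewrite pE; apply: (measure_preserving_fibred (a := id) (b := hx)).
  - by rewrite -pE; exact: measurable_graph.
  - exact: measure_preserving_id.
  - by apply: filterS aX0 => x; exact: fibre_law.
exists (QuotientSpace (standard_borel_prod stdX (standard_borel_R R)) mppi graph_tensor),
  (product_map T U).
have autTU := automorphism_product autT autU.
split; first split => //=.
  by apply: filterS hW => p; rewrite /pi /product_map /= => ->.
(* With these models both sides of the isomorphism are the same system. *)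
exists id, id => /=; split; first exact: measure_preserving_id.
by split; [exact: measure_preserving_id|split; [|split]; exact: aeW].
Qed.

End base_fibre.
End on_orbit.
End rigid_quotient.

Theorem corollary5 (R : realType)
  (dX : measure_display) (X : measurableType dX) (mu : probability X R)
  (T : X -> X)
  (G : topologicalZmodType) (phi : X -> G)
  (dY : measure_display) (Y : measurableType dY) (nu : probability Y R)
  (S : G -> Y -> Y)
  (stdX : standard_borel R X) (stdY : standard_borel R Y)
  (autT : automorphism mu T)
  (hausG : hausdorff_space G) (scG : @second_countable G)
  (lcG : locally_compact [set: G])
  (mphi : measurable_fun [set: X] (phi : X -> borelType G))
  (actS : group_action nu S)
  (mskew : measurable_fun [set: X * Y] (skew_product T phi S))
  (mmT : mildly_mixing mu T) :
  ~ mildly_mixing (mu \x nu)%E (skew_product T phi S) <->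
  exists A : set (set Y),
    [/\ forall g, factor nu (S g) A,
        nontrivial nu A &
        exists (Q : quotient_space nu A) (U : Q -> Q),
          [/\ automorphism (quo_prob Q) U,
              ~ mildly_mixing (quo_prob Q) U &
              exists (Q' : quotient_space (mu \x nu)%E (tensor_left X A))
                     (V : Q' -> Q'),
                restriction (skew_product T phi S) V /\
                isomorphic (quo_prob Q') V
                  (mu \x quo_prob Q)%E (product_map T U)]].
Proof.
have [autS SD _] := actS.
have mpS g : measure_preserving nu nu (S g) := (autS g).1.
have S0 : \forall y \ae nu, S 0 y = y.
  have [_ [S' [_ S'S _]]] := autS 0.
  (* [S 0] is idempotent because [0 + 0 = 0], and an invertible idempotent is the identity. *)
  have H := mp_ae (mpS 0) S'S.
  by apply: filterS3 (SD 0 0) S'S H => y; rewrite addr0 => E H2 H3; rewrite -[LHS]H3 -E.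
have mpW := measure_preserving_skew autT.1 mpS mskew.
split.
  move=> /(not_mildly_mixing_rigid_set mpW)[q [qoo [D ZD D01]]].
  have cXY := countably_generated_prod (standard_borel_countably_generated stdX)
    (standard_borel_countably_generated stdY).
  have [h [lambda [U [mph h01 Zh dh [autU hW rU]]]]] := rigid_sets_factor mpW qoo cXY.
  have [F mF DF] := dh _ ZD.
  have F01 : (0 < lambda F < 1)%E.
    rewrite -(mph.2 _ mF) -(setY0_measure _ _ DF)//.
      exact: rigid_sets_measurable ZD.
    exact: mp_measurable mph mF.
  have [X0 [aX0 orbX0]] := fibres_one_orbit stdX stdY autT mmT mpS S0 SD mskew qoo mph h01 Zh.
  have [x0 Xx0] := ae_nonempty aX0.
  exact: (quotient_isomorphic stdX stdY autT mpS S0 SD mskew mph Zh dh aX0 orbX0 Xx0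
    autU hW rU mF F01).
(* Conversely, the rigid factor of [U] is reached from [X * Y] by composing the quotient map to
   [Q'], the isomorphism, the second projection and the quotient map to [Q1]. *)
move=> [A [_ _ [Q [U [_ nmmU [Q' [V [[_ rV] [f [_ [mpf [_ [_ [_ fV]]]]]]]]]]]]]].
move: nmmU => /contrapT[A1 [[_ A1m _] [E A1E E01] [Q1 [V1 [[autV1 rV1] rigV1]]]]].
have [_ /(_ _ A1E)[_ [F mF <-] EF]] := quo_mapE Q1.
rewrite setTI in EF.
have mpQ' := quo_map_preserving Q'; have mpQ1 := quo_map_preserving Q1.
have mp1 := measure_preserving_comp mpQ' mpf.
have mp2 := measure_preserving_comp mp1 (measure_preserving_snd mu (quo_prob Q)).
have mp3 := measure_preserving_comp mp2 mpQ1.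
apply: (not_mildly_mixing_factor (quo_standard Q1) mp3 autV1 mpW _ rigV1 mF).
  have H1 := mp_ae mpQ' fV; have H2 := mp_ae mp2 rV1.
  by apply: filterS3 rV H1 H2 => p /= -> ->.
rewrite -(mpQ1.2 _ mF) -(setY0_measure (A1m _ A1E) _ EF)//.
exact: mp_measurable mpQ1 mF.
Qed.
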